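(* Let $\mathfrak g$ be a complex simple Lie algebra not of type $\mathsf A_{2p}$ ($p\ge1$). Then $\max(\Delta^+\setminus\Delta_{\langle\mathcal K\rangle})=-w_{\mathcal K}(\Pi_{\mathcal K}(1))$. In other words, for $\gamma\in\Delta^+$, one has $\gamma\in\max(\Delta^+\setminus\Delta_{\langle\mathcal K\rangle})$ if and only if $-w_{\mathcal K}^{-1}(\gamma)\in\Pi_{\mathcal K}(1)$.
   Context: Let $\mathfrak g$ be a complex simple Lie algebra, $\mathfrak t$ a Cartan subalgebra, $\Delta$ the root system, $\Delta^+$ a fixed set of positive roots, $\Delta^-=-\Delta^+$, $\Pi$ the simple roots, $\theta$ the highest root, $W$ the Weyl group. Let $(\ ,\ )$ be the positive-definite form on the $\mathbb Q$-span of $\Delta$ induced by the Killing form; it is used to identify $\mathfrak t$ and $\mathfrak t^*$. For $\gamma\in\Delta$ put $\gamma^\vee=2\gamma/(\gamma,\gamma)$. The root order on $\Delta^+$: $\gamma\preccurlyeq\gamma'$ if $\gamma'-\gamma$ is a non-negative integral combination of simple roots. Kostant cascade $\mathcal K=\{\beta_1,\dots,\beta_m\}\subset\Delta^+$: it is defined recursively. Its first element is $\beta_1=\theta$. The root system $\Delta_\theta=\{\gamma\in\Delta\mid(\gamma,\theta)=0\}$ is decomposed into irreducible components, each with the set of positive roots inherited from $\Delta^+$; the highest roots of these components are added to $\mathcal K$, and the procedure is repeated for each component until it terminates. The cascade element is $x_{\mathcal K}=\frac12\sum_{i=1}^m\beta_i^\vee\in\mathfrak t$. If $\mathfrak g$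 is not of type $\mathsf A_{2p}$, then $\gamma(x_{\mathcal K})\in\{-1,0,1,2\}$ for all $\gamma\in\Delta^+$. Put $\Delta^+_{\mathcal K}(i)=\{\gamma\in\Delta^+\mid\gamma(x_{\mathcal K})=i\}$ and $\Pi_{\mathcal K}(i)=\Pi\cap\Delta^+_{\mathcal K}(i)$. The element $w_{\mathcal K}\in W$ is the unique element with inversion set $\{\gamma\in\Delta^+\mid w_{\mathcal K}(\gamma)\in\Delta^-\}=\Delta^+_{\mathcal K}(1)\sqcup\Delta^+_{\mathcal K}(2)$. Put $\Delta_{\langle\mathcal K\rangle}=w_{\mathcal K}(\Delta^+_{\mathcal K}(-1))\sqcup w_{\mathcal K}(-\Delta^+_{\mathcal K}(2))\subset\Delta^+$; by a result of Kostant it is the set of roots of an abelian ideal $\mathfrak a_{\mathcal K}$ of the Borel subalgebra $\mathfrak b$, hence an upper ideal of $(\Delta^+,\preccurlyeq)$. $\max(\Delta^+\setminus\Delta_{\langle\mathcal K\rangle})$ is the set of maximal elements, with respect to $\preccurlyeq$, of the complement. *)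

(* Defs.v *)
From HB Require Import structures.
From mathcomp Require Import all_boot all_order all_algebra.
From mathcomp Require Import complex.
From mathcomp Require Import all_classical.
From mathcomp Require Import reals.

Set Implicit Arguments.
Unset Strict Implicit.
Unset Printing Implicit Defensive.

Import GRing.Theory.

Local Open Scope classical_set_scope.
Local Open Scope ring_scope.

(** * Finite-dimensional Lie algebras *)

HB.mixin Record Vector_isLie (F : fieldType) (g : Type) of Vector F g := {
  lie_bracket : g -> g -> g;
  lie_bracket_linearl : forall y, linear (lie_bracket^~ y);
  lie_bracket_linearr : forall x, linear (lie_bracket x);
  lie_bracketxx : forall x, lie_bracket x x = 0;
  lie_jacobi : forall x y z,
    lie_bracket x (lie_bracket y z) + lie_bracket y (lie_bracket z x)
      + lie_bracket z (lie_bracket x y) = 0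
}.

#[short(type="lieAlgType")]
HB.structure Definition Lie (F : fieldType) :=
  { g of Vector_isLie F g & Vector F g }.

Notation "[< x , y >]" := (lie_bracket x y)
  (at level 0, x, y at level 99, format "[< x ,  y >]") : ring_scope.

Section LieAlgebra.
Variables (F : fieldType) (g : lieAlgType F).

Definition lie_ideal (I : {vspace g}) : Prop :=
  forall x y : g, y \in I -> [< x, y >] \in I.

Definition simple_lie : Prop :=
  (exists x y : g, [< x, y >] <> 0) /\
  (forall I : {vspace g}, lie_ideal I -> I = 0%VS \/ I = fullv).

Definition ad (x : g) : 'End(g) := linfun (lie_bracket x).

Definition lfun_trace (f : 'End(g)) : F :=
  \tr (passmx.mxof (vbasis fullv) (vbasis fullv) f).

Definition killing (x y : g) : F := lfun_trace (ad x \o ad y)%VF.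

Definition ad_diagonalizable (h : g) : Prop :=
  exists e : seq g, basis_of fullv e /\
    forall x, x \in e -> exists c : F, [< h, x >] = c *: x.

(* Cartan subalgebra of a semisimple Lie algebra over an algebraically closed
   field of characteristic 0: a maximal commutative subalgebra all of whose
   elements are ad-diagonalizable. *)
Definition cartan_subalgebra (t : {vspace g}) : Prop :=
  [/\ forall h k, h \in t -> k \in t -> [< h, k >] = 0,
      forall x, (forall h, h \in t -> [< h, x >] = 0) -> x \in t
    & forall h, h \in t -> ad_diagonalizable h].

Variable t : {vspace g}.

Definition cartan_dual := 'Hom(subvs_of t, F^o).

Definition lie_roots : set cartan_dual :=
  [set a | a <> 0 /\
    exists2 x : g, x <> 0 & forall h : subvs_of t, [< vsval h, x >] = a h *: x].

(* The identification t -> t^* given by the Killing form, and its inverse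
   (the Killing form is nondegenerate on t when g is semisimple). *)
Definition flat : 'Hom(subvs_of t, cartan_dual) :=
  linfun (fun h : subvs_of t =>
    linfun (fun k : subvs_of t => killing (vsval h) (vsval k) : F^o) : cartan_dual).

Definition sharp : 'Hom(cartan_dual, subvs_of t) := (flat^-1)%VF.

Definition dual_form (a b : cartan_dual) : F :=
  killing (vsval (sharp a)) (vsval (sharp b)).

End LieAlgebra.

Arguments lie_roots {F g} t.
Arguments flat {F g} t.
Arguments sharp {F g} t.
Arguments dual_form {F g} t.

(** * Combinatorics of a root system [D] in a space with a symmetric form *)

Section Roots.
Variables (F : fieldType) (V : vectType F) (form : V -> V -> F).

Definition oppset (A : set V) : set V := [set - a | a in A].

Definition positive_system (D P : set V) : Prop :=
  [/\ D = P `|` oppset P, P `&` oppset P = set0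
    & forall a b, P a -> P b -> D (a + b) -> P (a + b)].

Definition simple_roots (P : set V) : set V :=
  [set a | P a /\ ~ exists b c, [/\ P b, P c & a = b + c]].

(* [b - a] is a non-negative integral combination of elements of [B], written
   as the sum of a finite sequence of elements of [B]. *)
Definition root_le (B : set V) (a b : V) : Prop :=
  exists2 s : seq V, (forall c, c \in s -> B c) & b - a = \sum_(c <- s) c.

Definition maximal_elements (B A : set V) : set V :=
  [set a | A a /\ forall b, A b -> root_le B a b -> b = a].

Definition coroot (a : V) : V := (2%:R / form a a) *: a.

Definition reflection (a : V) : 'End(V) :=
  linfun (fun v => v - form v (coroot a) *: a).

(* Reflections being involutions, this is the group they generate. *)
Inductive weyl_group (D : set V) : 'End(V) -> Prop :=
| weyl_id : weyl_group D \1%VF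
| weyl_reflection a w :
    D a -> weyl_group D w -> weyl_group D (reflection a \o w)%VF.

Definition inversion_set (P : set V) (w : 'End(V)) : set V :=
  [set a | P a /\ oppset P (w a)].

Definition irreducible_system (S : set V) : Prop :=
  S !=set0 /\
  forall A B, S = A `|` B -> (forall a b, A a -> B b -> form a b = 0) ->
    A = set0 \/ B = set0.

Definition irreducible_component (S C : set V) : Prop :=
  [/\ C `<=` S, irreducible_system C
    & forall a b, C a -> (S `\` C) b -> form a b = 0].

Definition highest_root (P : set V) (b : V) : Prop :=
  P b /\ forall a, P a -> root_le (simple_roots P) a b.

(* The irreducible subsystems met in the construction of the Kostant cascade
   of [D]; each contributes its highest root. *)
Inductive cascade_subsystem (D P : set V) : set V -> Prop :=
| cascade_top : cascade_subsystem D P D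
| cascade_next S b C :
    cascade_subsystem D P S -> highest_root (S `&` P) b ->
    irreducible_component [set a | S a /\ form a b = 0] C ->
    cascade_subsystem D P C.

Definition kostant_cascade (D P : set V) : set V :=
  [set b | exists2 S, cascade_subsystem D P S & highest_root (S `&` P) b].

(* The Dynkin diagram of the simple roots [B] is the simply laced path with
   [n] vertices. *)
Definition type_A (B : set V) (n : nat) : Prop :=
  exists a : 'I_n -> V,
    [/\ injective a, range a = B
      & forall i j : 'I_n, form (a i) (coroot (a j)) =
          if i == j then 2%:R
          else if (i.+1 == j) || (j.+1 == i) then - 1 else 0].

End Roots.

(** * The cascade element and the associated Weyl group element *)

Section Cascade.
Variables (F : fieldType) (g : lieAlgType F) (t : {vspace g}).
Variable P : set (cartan_dual t).

Let K := kostant_cascade (dual_form t) (lie_roots t) P.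

(* A finitely supported sum over the (finite) set [K]. *)
Definition cascade_element : subvs_of t :=
  2%:R^-1 *: \sum_(b \in K) sharp t (coroot (dual_form t) b).

Definition cascade_level (i : F) : set (cartan_dual t) :=
  [set a | P a /\ a cascade_element = i].

Definition cascade_weyl_element (w : 'End(cartan_dual t)) : Prop :=
  weyl_group (dual_form t) (lie_roots t) w /\
  inversion_set P w = cascade_level 1 `|` cascade_level 2%:R.

Definition cascade_ideal_roots (w : 'End(cartan_dual t)) : set (cartan_dual t) :=
  (w @` cascade_level (- 1)) `|` (w @` oppset (cascade_level 2%:R)).

End Cascade.

(* Main.v *)
Require Import Defs.
From HB Require Import structures.
From mathcomp Require Import all_boot all_order all_algebra.
From mathcomp Require Import complex.
From mathcomp Require Import all_classical.
From mathcomp Require Import reals.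
From mathcomp Require Import ring zify.

Set Implicit Arguments.
Unset Strict Implicit.
Unset Printing Implicit Defensive.

Import Order.TTheory GRing.Theory Num.Theory.

Local Open Scope classical_set_scope.
Local Open Scope ring_scope.

(** The statement concerns a root system with its form, its cascade and [w]; the
    Lie algebra only serves to produce that root system.

    The roots.  A Cartan subalgebra acts diagonally on [g], so a basis of weight
    vectors exists.  Root vectors [x], [y] of opposite weights act along strings
    of weights as in the representation theory of sl2 ([root_string]); if the
    Killing form were zero, this would force every [[< x, y >]] to be central,
    and the root vectors to span a proper ideal ([killing_nonzero]).  Hence the
    form is nondegenerate, the strings give the closure properties of roots and
    the positivity of the form ([lie_root_system]), and simplicity gives
    irreducibility ([lie_roots_irreducible]).

    The cascade.  Its subsystems form a tree, in which a subsystem below [S] is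
    orthogonal to the highest root of [S], and incomparable ones are orthogonal
    ([cascade_tree]); so the cascade roots are pairwise orthogonal and have level
    [1], where the level of [v] is its value at the cascade element.  A positive
    root [a] outside the cascade is attached to some cascade root [b], with
    [b - a] again a positive root, and the levels of [a] and [b - a] add up to
    [1] ([level_complement]).

    The complement of the ideal.  The roots that [w] keeps positive are those of
    level other than [1] and [2], which confines the levels to [-1, 0, 1, 2]
    ([level_values]) and makes the level of the preimage of a positive root
    nonpositive ([level_preimage]).  The complement of the ideal consists of the
    [w a] with [a] of level [0] and of the [- w a] with [a] of level [1].
    - If [a] is simple of level [1], then anything above [- w a] in the
      complement is [- w d] with [a = d + (positive roots)], so it is [- w a].
    - A root [w a] with [a] of level [0] lies under [- w (b - a)], for [b] the
      cascade root to which [a] is attached.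
    - If [a] of level [1] is not simple, it is a sum of positive roots [e] and
      [f] of levels [1] and [0], and [- w a] lies under [- w e].  The case to
      exclude is a decomposition with levels [2] and [-1] only: a cascade root
      can be moved from one summand to the other, or split off ([level_split]).
  *)

(** * Finite orders and sums *)

Lemma count_lt (T : eqType) (p q : pred T) (s : seq T) c :
  (forall d, p d -> q d) -> c \in s -> q c -> ~ p c ->
  (count p s < count q s)%N.
Proof.
move=> pq cs qc npc.
have : (count (predU (pred1 c) p) s <= count q s)%N.
  by apply: sub_count => d /= /orP[/eqP->|/pq].
apply: leq_trans.
have -> : count (predU (pred1 c) p) s = (count (pred1 c) s + count p s)%N.
  rewrite -count_predUI (_ : count (predI _ _) s = 0%N) ?addn0 //.
  apply/eqP; rewrite -leqn0 leqNgt -has_count -all_predC; apply/allP => d _ /=.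
  by apply/negP => /andP[/eqP->].
by rewrite -add1n leq_add2r -has_count has_pred1.
Qed.

Lemma finite_lt_ind (T : eqType) (Q : set T) (lt : T -> T -> Prop)
    (Pr : T -> Prop) :
  finite_set Q -> (forall a, ~ lt a a) ->
  (forall a b c, lt a b -> lt b c -> lt a c) ->
  (forall a, Q a -> (forall c, Q c -> lt c a -> Pr c) -> Pr a) ->
  forall a, Q a -> Pr a.
Proof.
move=> /finite_seqP[s ->] irr tr step a Qa.
pose rank b := count (fun c => `[< lt c b >]) s.
have [n le_n] := ubnP (rank a); elim: n => // n IHn in a Qa le_n *.
apply: step => // c Qc ltca; apply: IHn => //; rewrite ltnS in le_n.
apply: leq_trans le_n; apply: (@count_lt _ _ _ _ c) => //.
- by move=> d /asboolP ltdc; apply/asboolP/(tr _ _ _ ltdc).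
- exact/asboolP.
- by move=> /asboolP; apply: irr.
Qed.

Lemma sum_gt0_exists (F : numFieldType) (T : eqType) (s : seq T) (f : T -> F) :
  (forall c, c \in s -> f c \is Num.real) ->
  0 < \sum_(c <- s) f c -> exists2 c, c \in s & 0 < f c.
Proof.
move=> freal; apply: contraPP => nopos; apply/negP.
suff fs0 : \sum_(c <- s) f c <= 0 by rewrite le_gtF.
rewrite big_seq sumr_le0 // => c cs.
by rewrite real_leNgt ?real0 ?freal//; apply/negP => c0; apply: nopos; exists c.
Qed.

(** * Root systems in a space with a form *)

Section RootSystem.
Variables (F : numFieldType) (V : vectType F) (form : V -> V -> F).

Record symmetric_bilinear : Prop := SymmetricBilinear {
  form_sym : forall a b, form a b = form b a;
  form_addl : forall a b c, form (a + b) c = form a c + form b c;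
  form_scalel : forall k a b, form (k *: a) b = k * form a b }.

(** [roots_sub] and [roots_orth] are the traces of root strings that the
    combinatorics needs; stated without reflections, the axioms pass at once to
    the subsystems of the cascade. *)
Record root_system (D : set V) : Prop := RootSystem {
  roots_finite : finite_set D;
  roots_opp : forall a, D a -> D (- a);
  roots_real : forall a b, D a -> D b -> form a b \is Num.real;
  roots_pos : forall a, D a -> 0 < form a a;
  roots_sub : forall a b, D a -> D b -> 0 < form a b -> a <> b -> D (a - b);
  roots_orth : forall a b, D a -> D b -> form a b = 0 -> D (a + b) ->
    D (a - b) }.

Hypothesis formP : symmetric_bilinear.

Let formC := form_sym formP.
Let formDl := form_addl formP.

Lemma formDr a b c : form c (a + b) = form c a + form c b.
Proof. by rewrite formC formDl ![form _ c]formC. Qed.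

Lemma formNl a b : form (- a) b = - form a b.
Proof. by rewrite -scaleN1r (form_scalel formP) mulN1r. Qed.

Lemma formNr a b : form b (- a) = - form b a.
Proof. by rewrite formC formNl formC. Qed.

Lemma formBl a b c : form (a - b) c = form a c - form b c.
Proof. by rewrite formDl formNl. Qed.

Lemma formBr a b c : form c (a - b) = form c a - form c b.
Proof. by rewrite formDr formNr. Qed.

Lemma form0l a : form 0 a = 0.
Proof. by rewrite -(subrr 0) formBl subrr. Qed.

Lemma form0r a : form a 0 = 0.
Proof. by rewrite formC form0l. Qed.

Lemma form_suml (s : seq V) a : form (\sum_(c <- s) c) a = \sum_(c <- s) form c a.
Proof.
by elim: s => [|c s IHs]; rewrite ?big_nil ?form0l // !big_cons formDl IHs.
Qed.

Lemma form_sumr (s : seq V) a : form a (\sum_(c <- s) c) = \sum_(c <- s) form a c.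
Proof. by rewrite formC form_suml; apply: eq_bigr => c _; rewrite formC. Qed.

Lemma form_coroot v b : form v (coroot form b) = 2%:R / form b b * form v b.
Proof. by rewrite /coroot formC (form_scalel formP) formC. Qed.

(** * Positive systems *)

Section PositiveSystem.
Variables (S Q : set V).
Hypotheses (rsS : root_system S) (psQ : positive_system S Q).

Lemma roots_neq0 a : S a -> a <> 0.
Proof. by move=> Sa a0; have := roots_pos rsS Sa; rewrite a0 form0l ltxx. Qed.

Lemma pos_sub a : Q a -> S a.
Proof. by case: psQ => -> _ _ Qa; left. Qed.

Lemma pos_oppF a : Q a -> Q (- a) -> False.
Proof.
case: psQ => _ QI _ Qa QNa; suff : (Q `&` oppset Q) a by rewrite QI.
by split => //; exists (- a) => //; rewrite opprK.
Qed.

Lemma pos_or_opp a : S a -> Q a \/ Q (- a).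
Proof.
by case: psQ => -> _ _ [|[b Qb <-]]; [left | right; rewrite opprK].
Qed.

Lemma pos_add a b : Q a -> Q b -> S (a + b) -> Q (a + b).
Proof. by case: psQ => _ _; apply. Qed.

Lemma pos_neq0 a : Q a -> a <> 0.
Proof. by move=> /pos_sub/roots_neq0. Qed.

Lemma pos_add_obtuse a b : Q a -> Q b -> form a b < 0 -> Q (a + b).
Proof.
move=> Qa Qb ab; apply: pos_add => //; rewrite -[b]opprK.
apply: (roots_sub rsS); [exact: pos_sub | exact/(roots_opp rsS)/pos_sub | |].
  by rewrite formNr oppr_gt0.
by move=> aNb; apply: (pos_oppF Qb); rewrite -aNb.
Qed.

Lemma pos_sub_acute a b : Q a -> Q b -> 0 < form a b -> a <> b ->
  Q (a - b) \/ Q (b - a).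
Proof.
move=> Qa Qb ab neq; rewrite -[X in _ \/ Q X]opprB; apply: pos_or_opp.
by apply: (roots_sub rsS) => //; exact: pos_sub.
Qed.

(** If [a] is the opposite of the sum of the other terms, one of them makes an
    obtuse angle with [a]; replacing both by their sum, a positive root, gives a
    shorter vanishing sum. *)
Lemma pos_sum_neq0 (s : seq V) :
  s <> [::] -> (forall c, c \in s -> Q c) -> \sum_(c <- s) c <> 0.
Proof.
have [n] := ubnP (size s); elim: n s => // n IHn [//|a s] /= sz _ Qs.
rewrite big_cons => /eqP; rewrite addrC addr_eq0 => /eqP sumE.
have Qa : Q a by apply: Qs; rewrite mem_head.
have [c cs ac] : exists2 c, c \in s & 0 < form (- a) c.
  apply: sum_gt0_exists => [c cs|].
    rewrite formNl realN (roots_real rsS) //; apply: pos_sub => //.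
    by apply: Qs; rewrite inE cs orbT.
  by rewrite -form_sumr sumE formNl formNr opprK (roots_pos rsS) //; apply: pos_sub.
have Qc : Q c by apply: Qs; rewrite inE cs orbT.
have szr : (size (rem c s)).+1 = size s.
  by rewrite size_rem // prednK //; case: (s) cs.
apply: (IHn (a + c :: rem c s)) => //.
- by rewrite /= szr.
- move=> d; rewrite inE => /predU1P[->|/mem_rem ds].
    by apply: pos_add_obtuse => //; rewrite -oppr_gt0 -formNl.
  by apply: Qs; rewrite inE ds orbT.
- by move: sumE; rewrite (big_rem c cs) /= big_cons -addrA => ->; rewrite subrr.
Qed.

Definition pos_lt (a b : V) : Prop :=
  exists s, [/\ s <> [::], forall c, c \in s -> Q c & b - a = \sum_(c <- s) c].

Lemma pos_lt_irr a : ~ pos_lt a a.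
Proof. by case=> s [s0 Qs]; rewrite subrr => /esym; apply: pos_sum_neq0. Qed.

Lemma pos_lt_trans a b c : pos_lt a b -> pos_lt b c -> pos_lt a c.
Proof.
move=> [s [s0 Qs sE]] [u [u0 Qu uE]]; exists (s ++ u); split.
- by case: (s) s0.
- by move=> d; rewrite mem_cat => /orP[/Qs|/Qu].
- by rewrite big_cat /= -sE -uE addrC subrKA.
Qed.

Lemma pos_lt_root a b : Q (b - a) -> pos_lt a b.
Proof.
by move=> Qba; exists [:: b - a]; split=> [//|c|]; rewrite ?inE ?big_seq1 // => /eqP->.
Qed.

Lemma pos_lt_addr a b : Q b -> pos_lt a (a + b).
Proof. by move=> Qb; apply: pos_lt_root; rewrite addrC addKr. Qed.

Lemma pos_lt_addl a b : Q a -> pos_lt b (a + b).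
Proof. by rewrite addrC; apply: pos_lt_addr. Qed.

Lemma pos_finite : finite_set Q.
Proof. exact: sub_finite_set pos_sub (roots_finite rsS). Qed.

Lemma pos_ind (Pr : V -> Prop) :
  (forall a, Q a -> (forall c, Q c -> pos_lt c a -> Pr c) -> Pr a) ->
  forall a, Q a -> Pr a.
Proof.
by apply: (finite_lt_ind pos_finite pos_lt_irr); exact: pos_lt_trans.
Qed.

Lemma nsimple_split a : Q a -> ~ simple_roots Q a ->
  exists b c, [/\ Q b, Q c & a = b + c].
Proof. by move=> Qa nsa; apply: contrapT => nbc; apply: nsa; split. Qed.

Lemma root_le_trans (B : set V) a b c :
  root_le B a b -> root_le B b c -> root_le B a c.
Proof.
move=> [s Bs sE] [u Bu uE]; exists (s ++ u).
  by move=> d; rewrite mem_cat => /orP[/Bs|/Bu].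
by rewrite big_cat /= -sE -uE addrC subrKA.
Qed.

Lemma root_le_refl (B : set V) a : root_le B a a.
Proof. by exists [::] => //; rewrite big_nil subrr. Qed.

Lemma root_le_pos a : Q a -> root_le (simple_roots Q) 0 a.
Proof.
elim/pos_ind=> {}a Qa IH; have [sa|nsa] := pselect (simple_roots Q a).
  exists [:: a]; last by rewrite big_seq1 subr0.
  by move=> c; rewrite inE => /eqP->.
have [b [c [Qb Qc aE]]] := nsimple_split Qa nsa.
have [s ss sE] := IH b Qb (ltac:(rewrite aE; exact: pos_lt_addr)).
have [u su uE] := IH c Qc (ltac:(rewrite aE; exact: pos_lt_addl)).
exists (s ++ u) => [d|]; first by rewrite mem_cat => /orP[/ss|/su].
by rewrite big_cat /= -sE -uE !subr0.
Qed.

Lemma root_le_shift (B : set V) a b c : root_le B a b -> root_le B (a + c) (b + c).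
Proof. by move=> [s Bs sE]; exists s => //; rewrite opprD addrACA subrr addr0. Qed.

Lemma root_le_sub a b : Q (b - a) -> root_le (simple_roots Q) a b.
Proof. by move=> /root_le_pos/(root_le_shift a); rewrite add0r subrK. Qed.

Lemma pos_lt_root_le a b : pos_lt a b -> root_le (simple_roots Q) a b.
Proof.
case=> s [_ Qs]; elim: s b Qs => [|c s IHs] b Qs.
  by rewrite big_nil => /eqP; rewrite subr_eq0 => /eqP->; apply: root_le_refl.
rewrite big_cons => sE; apply: (root_le_trans (b := b - c)); last first.
  by apply: root_le_sub; rewrite subKr; apply: Qs; rewrite mem_head.
apply: IHs; first by move=> d ds; apply: Qs; rewrite inE ds orbT.
by rewrite addrAC sE addrC addKr.
Qed.

Lemma simple_pos a : simple_roots Q a -> Q a.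
Proof. by case. Qed.

Lemma root_le_pos_lt a b : root_le (simple_roots Q) a b -> a = b \/ pos_lt a b.
Proof.
move=> [[|c s] Bs sE]; [left | right].
  by apply/esym/eqP; rewrite -subr_eq0 sE big_nil.
by exists (c :: s); split=> // d /Bs/simple_pos.
Qed.

Lemma root_le_anti a b : root_le (simple_roots Q) a b ->
  root_le (simple_roots Q) b a -> a = b.
Proof.
move=> /root_le_pos_lt[//|ab] /root_le_pos_lt[//|ba].
by case: (pos_lt_irr (pos_lt_trans ab ba)).
Qed.

Lemma simple_obtuse a b : simple_roots Q a -> simple_roots Q b -> a <> b ->
  form a b <= 0.
Proof.
move=> [Qa ida] [Qb idb] neq.
rewrite real_leNgt ?real0 ?(roots_real rsS) //; try exact: pos_sub.
apply/negP => ab; have [Qab|Qba] := pos_sub_acute Qa Qb ab neq.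
  by apply: ida; exists b, (a - b); rewrite subrKC.
by apply: idb; exists a, (b - a); rewrite subrKC.
Qed.

(** If [a] is such a sum, some summand [c] has [(a, c) > 0], so [a - c] is a
    root.  If it is positive, it splits the simple root [a]; if it is negative,
    its opposite and the other summands are positive roots of sum zero. *)
Lemma simple_not_sum a b s : simple_roots Q a -> Q b -> s <> [::] ->
  (forall c, c \in s -> Q c) -> a <> b + \sum_(c <- s) c.
Proof.
move=> [Qa ida] Qb s0 Qs aE.
have Qbs c : c \in b :: s -> Q c by rewrite inE => /predU1P[->|/Qs].
have [c cs ac] : exists2 c, c \in b :: s & 0 < form a c.
  apply: sum_gt0_exists => [c cs|].
    by rewrite (roots_real rsS) //; apply: pos_sub => //; exact: Qbs.
  by rewrite -form_sumr big_cons -aE (roots_pos rsS) //; apply: pos_sub.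
have Qc := Qbs c cs.
have rest : a - c = \sum_(d <- rem c (b :: s)) d.
  have -> : a = \sum_(d <- b :: s) d by rewrite big_cons.
  by rewrite (big_rem c cs) /= addrAC subrr add0r.
have Qrem d : d \in rem c (b :: s) -> Q d by move=> /mem_rem/Qbs.
have rem0 : rem c (b :: s) <> [::].
  move=> /(congr1 size); rewrite size_rem //=.
  by move=> /size0nil.
have neq : a <> c.
  by move=> ac0; apply: (pos_sum_neq0 rem0 Qrem); rewrite -rest ac0 subrr.
have [Qac|Qca] := pos_sub_acute Qa Qc ac neq.
  by apply: ida; exists c, (a - c); rewrite subrKC.
apply: (@pos_sum_neq0 (c - a :: rem c (b :: s))) => //.
  by move=> d; rewrite inE => /predU1P[->|/Qrem].
by rewrite big_cons -rest -opprB addNr.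
Qed.

(** * Highest roots *)

(** Otherwise [b + a] would be a root above [b]. *)
Lemma highest_dominant b a : highest_root Q b -> Q a -> 0 <= form b a.
Proof.
move=> [Qb maxb] Qa.
rewrite real_leNgt ?real0 ?(roots_real rsS) //; try exact: pos_sub.
apply/negP => /(pos_add_obtuse Qb Qa) Qba.
have [E|ba] := root_le_pos_lt (maxb _ Qba).
  by apply: (pos_lt_irr (a := b)); rewrite -{2}E; apply: pos_lt_addr.
exact: (pos_lt_irr (pos_lt_trans (pos_lt_addr b Qa) ba)).
Qed.

Lemma highest_root_unique b c : highest_root Q b -> highest_root Q c -> b = c.
Proof. by move=> [Qb bP] [Qc cP]; apply: root_le_anti; [apply: cP | apply: bP]. Qed.

Lemma highest_root_diff b a : highest_root Q b -> Q a -> 0 < form b a ->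
  a <> b -> Q (b - a).
Proof.
move=> [Qb maxb] Qa ba neq.
have [//|Qab] := pos_sub_acute Qb Qa ba (nesym neq).
have [E|ltab] := root_le_pos_lt (maxb _ Qa); first by case: neq.
by case: (pos_lt_irr (pos_lt_trans ltab (pos_lt_root Qab))).
Qed.

Let maximal b := Q b /\ forall c, Q c -> ~ Q (b + c).

Let maximal_above a : Q a -> exists2 b, maximal b & a = b \/ pos_lt a b.
Proof.
move: a; apply: (finite_lt_ind (lt := fun x y => pos_lt y x)).
- exact: pos_finite.
- exact: pos_lt_irr.
- by move=> x y z yx zy; apply: pos_lt_trans zy yx.
move=> a Qa IH; have [maxa|] := pselect (forall c, Q c -> ~ Q (a + c)).
  by exists a; [split | left].
move=> /existsNP[c /not_implyP[Qc /contrapT Qac]].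
have [b maxb ab] := IH _ Qac (pos_lt_addr a Qc).
exists b => //; right; have altac := pos_lt_addr a Qc.
by case: ab => [ <-//|]; apply: pos_lt_trans.
Qed.

Let maximal_dominant b a : maximal b -> Q a -> 0 <= form b a.
Proof.
move=> [Qb maxb] Qa.
rewrite real_leNgt ?real0 ?(roots_real rsS) //; try exact: pos_sub.
by apply/negP => /(pos_add_obtuse Qb Qa); apply: maxb.
Qed.

Hypothesis irrS : irreducible_system form S.

(** A simple root [d] outside the support of a maximal [b] satisfies [(b, d) >= 0],
    while no simple root of the support contributes positively: so [d] is
    orthogonal to the support.  Roots are then combinations of the support
    alone, or of the other simple roots alone: for a sum [a1 + a2] of one of each
    kind, [a1 - a2] would be a root, up to sign positive and lower, so of one of
    the two kinds, and orthogonal to [a1] or to [a2].  These two kinds of roots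
    split the irreducible system [S]. *)
Let maximal_support b (s : seq V) : maximal b ->
  (forall c, c \in s -> simple_roots Q c) -> b = \sum_(c <- s) c ->
  forall c, simple_roots Q c -> c \in s.
Proof.
move=> maxb ss bE c sc; apply/negPn/negP => cs.
pose off d := simple_roots Q d /\ d \notin s.
have orth d e : off d -> e \in s -> form d e = 0.
  move=> [sd ds] es.
  have nonpos e' : e' \in s -> form d e' <= 0.
    by move=> e's; apply: simple_obtuse (ss _ e's) _ => // de; rewrite de e's in ds.
  have sum0 : \sum_(e' <- s) form d e' = 0.
    apply/eqP; rewrite eq_le big_seq sumr_le0 // -big_seq -form_sumr -bE formC.
    by rewrite maximal_dominant //; apply: simple_pos.
  move/eqP: sum0; rewrite big_seq -oppr_eq0 -sumrN psumr_eq0.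
    by move=> /allP/(_ _ es); rewrite es oppr_eq0 => /eqP.
  by move=> e' e's; rewrite oppr_ge0 nonpos.
pose comb (X : V -> Prop) a :=
  exists2 u : seq V, (forall d, d \in u -> X d) & a = \sum_(d <- u) d.
have comb_add X a a' : comb X a -> comb X a' -> comb X (a + a').
  move=> [u Xu ->] [v Xv ->]; exists (u ++ v); last by rewrite big_cat.
  by move=> d; rewrite mem_cat => /orP[/Xu|/Xv].
have comb_orth a a' : comb (fun d => d \in s) a -> comb off a' -> form a a' = 0.
  move=> [u su ->] [v ov ->]; rewrite form_suml big_seq big1 // => d /su ds.
  by rewrite form_sumr big_seq big1 // => e /ov oe; rewrite formC orth.
have split_pos a : Q a -> comb (fun d => d \in s) a \/ comb off a.
  elim/pos_ind=> {}a Qa IH.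
  have [sa|nsa] := pselect (simple_roots Q a).
    have [as_|nas] := boolP (a \in s); [left | right]; exists [:: a];
      rewrite ?big_seq1 // => d; rewrite inE => /eqP-> //.
  have mixed a1 a2 : Q a1 -> Q a2 -> a = a1 + a2 ->
      comb (fun d => d \in s) a1 -> comb off a2 -> False.
    move=> Q1 Q2 aE c1 c2; have o12 := comb_orth _ _ c1 c2.
    have S12 : S (a1 - a2).
      apply: (roots_orth rsS) => //; try exact: pos_sub.
      by rewrite -aE; apply: pos_sub.
    have p1 := roots_pos rsS (pos_sub Q1); have p2 := roots_pos rsS (pos_sub Q2).
    have [Q12|Q21] := pos_or_opp S12.
      have lt12 : pos_lt (a1 - a2) a.
        apply: (pos_lt_trans (b := a1)); first by apply: pos_lt_root; rewrite subKr.
        by rewrite aE; apply: pos_lt_addr.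
      have [c12|c12] := IH _ Q12 lt12.
        by have := comb_orth _ _ c12 c2; rewrite formBl o12 sub0r => /eqP;
           rewrite oppr_eq0 gt_eqF.
      by have := comb_orth _ _ c1 c12; rewrite formBr o12 subr0 => /eqP;
         rewrite gt_eqF.
    rewrite opprB in Q21.
    have lt21 : pos_lt (a2 - a1) a.
      apply: (pos_lt_trans (b := a2)); first by apply: pos_lt_root; rewrite subKr.
      by rewrite aE; apply: pos_lt_addl.
    have [c21|c21] := IH _ Q21 lt21.
      by have := comb_orth _ _ c21 c2; rewrite formBl o12 subr0 => /eqP;
         rewrite gt_eqF.
    by have := comb_orth _ _ c1 c21; rewrite formBr o12 sub0r => /eqP;
       rewrite oppr_eq0 gt_eqF.
  have [a1 [a2 [Q1 Q2 aE]]] := nsimple_split Qa nsa.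
  have lt1 : pos_lt a1 a by rewrite aE; apply: pos_lt_addr.
  have lt2 : pos_lt a2 a by rewrite aE; apply: pos_lt_addl.
  have [c1|c1] := IH _ Q1 lt1; have [c2|c2] := IH _ Q2 lt2.
  - by left; rewrite aE; apply: comb_add.
  - by case: (mixed a1 a2).
  - by case: (mixed a2 a1) => //; rewrite addrC.
  - by right; rewrite aE; apply: comb_add.
pose ext (X : V -> Prop) := [set a | S a /\ (comb X a \/ comb X (- a))].
have [_ /(_ (ext (fun d => d \in s)) (ext off))] := irrS; case.
- apply/seteqP; split=> [a Sa|a [[]//|[]//]].
  have [/split_pos|/split_pos] := pos_or_opp Sa; case=> ca;
    by [left; split=> //; auto | right; split=> //; auto].
- move=> a a' [_ ca] [_ ca'].
  case: ca => ca; case: ca' => ca'; have := comb_orth _ _ ca ca';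
    rewrite ?formNl ?formNr ?opprK // => /eqP; rewrite ?oppr_eq0 => /eqP //.
- move=> /seteqP[/(_ b) sub _]; apply: sub; split; first by apply/pos_sub/maxb.1.
  by left; exists s.
- move=> /seteqP[/(_ c) sub _]; apply: sub; split; first by apply/pos_sub/simple_pos.
  by left; exists [:: c]; rewrite ?big_seq1 // => d; rewrite inE => /eqP->.
Qed.

(** Two maximal roots [b] and [b'] have [(b, b') > 0], since the support of [b']
    contains all simple roots and [b] is dominant; were they distinct, [b - b']
    would be a root and one of them would not be maximal. *)
Lemma highest_root_exists : exists b, highest_root Q b.
Proof.
have [[a Sa] _] := irrS.
have [a' Qa'] : exists a', Q a'.
  by have [|] := pos_or_opp Sa; [exists a | exists (- a)].
have [b maxb _] := maximal_above Qa'.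
have [s ss] := root_le_pos maxb.1; rewrite subr0 => bE.
exists b; split=> [|c Qc]; first exact: maxb.1.
have [b' maxb' cb'] := maximal_above Qc.
suff -> : b = b'.
  by case: cb' => [->|/pos_lt_root_le//]; apply: root_le_refl.
have [u su] := root_le_pos maxb'.1; rewrite subr0 => b'E.
apply: contrapT => neq.
have pair_pos : 0 < form b b'.
  rewrite lt0r maximal_dominant //; last exact: maxb'.1.
  rewrite andbT; apply/eqP => bb'0.
  have orth e : e \in u -> form b e = 0.
    move/eqP: bb'0; rewrite b'E form_sumr big_seq psumr_eq0.
      by move=> /allP P0 eu; move: (P0 _ eu); rewrite eu => /eqP.
    by move=> d /su/simple_pos; apply: maximal_dominant.
  have := roots_pos rsS (pos_sub maxb.1).
  rewrite {2}bE form_sumr big_seq big1 ?ltxx // => d /ss sd.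
  exact/orth/(maximal_support maxb' su b'E).
have [Qd|Qd] := pos_sub_acute maxb.1 maxb'.1 pair_pos neq.
  by apply: (maxb'.2 _ Qd); rewrite subrKC; exact: maxb.1.
by apply: (maxb.2 _ Qd); rewrite subrKC; exact: maxb'.1.
Qed.

End PositiveSystem.

(** * The Kostant cascade *)

Section Cascade.
Variables D P : set V.
Hypotheses (rsD : root_system D) (psP : positive_system D P).
Hypothesis irrD : irreducible_system form D.

(** What the subsystems of the cascade inherit from [D]; [face_add] says that the
    positive roots of [S] are the positive roots in a face of the cone spanned by
    [P]. *)
Record closed_face (S : set V) : Prop := ClosedFace {
  face_sub : S `<=` D;
  face_opp : forall a, S a -> S (- a);
  face_diff : forall a b, S a -> S b -> D (a - b) -> S (a - b);
  face_add : forall a b, P a -> P b -> S (a + b) -> S a /\ S b }.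

Lemma face_root_system S : closed_face S -> root_system S.
Proof.
move=> [SD SN SB _]; split=> [|//|a b /SD Da /SD Db|a /SD Da|a b Sa Sb ab neq|].
- exact: sub_finite_set SD (roots_finite rsD).
- exact: (roots_real rsD).
- exact: (roots_pos rsD).
- by apply: SB => //; apply: (roots_sub rsD) => //; exact: SD.
- move=> a b Sa Sb ab Sab; apply: SB => //.
  by apply: (roots_orth rsD) => //; exact: SD.
Qed.

Lemma face_positive S : closed_face S -> positive_system S (S `&` P).
Proof.
move=> [SD SN SB _]; split.
- apply/seteqP; split=> [a Sa|a [[]//|[b [Sb _] <-]]]; last exact: SN.
  have [Pa|PNa] := pos_or_opp psP (SD _ Sa); first by left.
  by right; exists (- a); [split=> //; exact: SN | rewrite opprK].
- apply/seteqP; split=> [a [[_ Pa] [b [_ Pb] ba]]|//].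
  by apply: (pos_oppF psP Pb); rewrite ba.
- move=> a b [Sa Pa] [Sb Pb] Sab; split=> //.
  by apply: (pos_add psP) => //; exact: SD.
Qed.

(** The highest root [b] of [S] is dominant on [S], hence a sum of positive roots
    orthogonal to [b] has both terms orthogonal to [b]. *)
Lemma orthogonal_face S b : closed_face S -> highest_root (S `&` P) b ->
  closed_face [set a | S a /\ form a b = 0].
Proof.
move=> fS hb; have [SD SN SB SF] := fS; split.
- by move=> a [/SD].
- by move=> a [Sa ab]; split; [exact: SN | rewrite formNl ab oppr0].
- move=> a c [Sa ab] [Sc cb] Dac; split; first exact: SB.
  by rewrite formBl ab cb subrr.
- move=> a c Pa Pc [Sac acb]; have [Sa Sc] := SF _ _ Pa Pc Sac.
  have dom x : S x -> P x -> 0 <= form x b.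
    move=> Sx Px; rewrite formC.
    exact: (highest_dominant (face_root_system fS) (face_positive fS) hb).
  move/eqP: acb; rewrite formDl paddr_eq0 ?dom // => /andP[/eqP ab /eqP cb].
  by split.
Qed.

(** A root of [T] that is not orthogonal to some root of [C] lies in [C].  If
    [a + c] is in [C], it is not orthogonal to both [a] and [c]. *)
Lemma component_face T C : closed_face T -> irreducible_component form T C ->
  closed_face C.
Proof.
move=> [TD TN TB TF] [CT _ Corth].
have linked a c : C a -> T c -> form a c <> 0 -> C c.
  by move=> Ca Tc ac; apply: contrapT => nCc; apply: ac; apply: Corth.
have self a : C a -> 0 < form a a by move=> /CT/TD/(roots_pos rsD).
have diff a c : C a -> C c -> T (a - c) -> C (a - c).
  move=> Ca Cc Tac; apply: contrapT => nCac.
  have o x : C x -> form x (a - c) = 0 by move=> Cx; apply: Corth.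
  have := roots_pos rsD (TD _ Tac).
  by rewrite {1}[a - c]/(a - c) formBl !o // subrr ltxx.
split.
- by move=> a /CT/TD.
- move=> a Ca; apply: (linked a) => //; first exact/TN/CT.
  by rewrite formNr => /eqP; rewrite oppr_eq0 gt_eqF // self.
- by move=> a c Ca Cc Dac; apply: diff => //; apply: TB => //; exact: CT.
- move=> a c Pa Pc Cac; have [Ta Tc] := TF _ _ Pa Pc (CT _ Cac).
  have [ac0|ac] := eqVneq (form (a + c) a) 0; last first.
    have Ca : C a by apply: (linked (a + c)) => //; apply/eqP.
    have cE : c = a + c - a by rewrite addrAC subrr add0r.
    by split=> //; rewrite cE; apply: diff; rewrite -?cE.
  have Cc : C c.
    apply: (linked (a + c)) => // cc; have := self _ Cac.
    by rewrite formDr ac0 cc addr0 ltxx.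
  by split=> //; rewrite -[a](addrK c); apply: diff; rewrite ?addrK.
Qed.

Lemma cascade_face S : cascade_subsystem form D P S ->
  closed_face S /\ irreducible_system form S.
Proof.
elim=> [|T b C _ [fT irrT] hb compC].
  split=> //; split=> // [a|a b Pa Pb _]; first exact: (roots_opp rsD).
  by split; apply: (pos_sub psP).
split; last by case: compC.
exact: component_face (orthogonal_face fT hb) compC.
Qed.

Lemma cascade_highest S : cascade_subsystem form D P S ->
  exists b, highest_root (S `&` P) b.
Proof.
move=> /cascade_face[fS irrS].
exact: highest_root_exists (face_root_system fS) (face_positive fS) irrS.
Qed.

(** The component is the smallest orthogonal direct factor containing [a]. *)
Lemma component_through T a : closed_face T -> T a ->
  exists2 C, irreducible_component form T C & C a.
Proof.
move=> fT Ta.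
have self x : T x -> form x x <> 0.
  by move=> /(face_sub fT)/(roots_pos rsD) xx x0; rewrite x0 ltxx in xx.
pose summand A := A `<=` T /\ forall x y, A x -> (T `\` A) y -> form x y = 0.
pose C := [set x | forall A, summand A -> A a -> A x].
have CT : C `<=` T by move=> x; apply=> //; split=> // ? ? _ [].
have Corth x y : C x -> (T `\` C) y -> form x y = 0.
  move=> Cx [Ty /existsNP[A /not_implyP[sA /not_implyP[Aa nAy]]]].
  by apply: sA.2; [exact: Cx | split].
have Ca : C a by [].
exists C => //; split=> //; split; first by exists a.
have main A B : A a -> C = A `|` B -> (forall x y, A x -> B y -> form x y = 0) ->
    B = set0.
  move=> Aa CE AB; have AC : A `<=` C by rewrite CE => x; left.
  have sA : summand A.
    split=> [x /AC/CT//|x y Ax [Ty nAy]].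
    have [Cy|nCy] := pselect (C y); last by apply: Corth => //; apply: AC.
    by apply: AB => //; move: Cy; rewrite CE => -[].
  apply/seteqP; split=> // y By; have Cy : C y by rewrite CE; right.
  by case: (self y (CT _ Cy)); apply: AB By; apply: Cy.
move=> A B CE AB; move: (Ca); rewrite {1}CE => -[Aa|Ba].
  by right; apply: main AB.
left; apply: (main B A) => //; first by rewrite setUC.
by move=> x y Bx Ay; rewrite formC AB.
Qed.

(** As long as [a] is orthogonal to the highest root of the current subsystem, it
    survives in a component of the next step, which is smaller since it misses
    that highest root. *)
Lemma cascade_attached a : P a -> exists S b,
  [/\ cascade_subsystem form D P S, highest_root (S `&` P) b, S a
    & form a b <> 0].
Proof.
move=> Pa; have Da := pos_sub psP Pa.
have [s Ds] := iffLR (finite_seqP _) (roots_finite rsD).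
pose size_of S := count (fun c => `[< S c >]) s.
suff main n S : cascade_subsystem form D P S -> S a -> (size_of S < n)%N ->
    exists S b, [/\ cascade_subsystem form D P S, highest_root (S `&` P) b,
      S a & form a b <> 0].
  exact: (main (size_of D).+1 D (cascade_top _ _ _)).
elim: n S => // n IHn S cS Sa; rewrite ltnS => le_n.
have [b hb] := cascade_highest cS; have [fS _] := cascade_face cS.
have [ab|ab] := eqVneq (form a b) 0; last by exists S, b; split=> //; apply/eqP.
have [C compC Ca] := component_through (orthogonal_face fS hb) (conj Sa ab).
apply: (IHn C) => //; first exact: cascade_next cS hb compC.
apply: leq_trans le_n; have [[Sb _] _] := hb; have Db := face_sub fS Sb.
have CS c : C c -> S c /\ form c b = 0 by have [sub _ _] := compC; apply: sub.
apply: (@count_lt _ _ _ _ b).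
- by move=> d /asboolP/CS[Sd _]; apply/asboolP.
- by move: Db; rewrite Ds.
- exact/asboolP.
- by move=> /asboolP/CS[_] b0; have := roots_pos rsD Db; rewrite b0 ltxx.
Qed.

Definition orthogonal_to_highest (S T : set V) : Prop :=
  forall b, highest_root (T `&` P) b -> forall a, S a -> T a /\ form a b = 0.

(** Induction on both derivations.  The case to settle is that of a component [C]
    of [S1] below [b1] and a component [C'] of [S2] below [b2], each contained in
    the subsystem of which the other is a component: two irreducible sets in this
    position coincide or are orthogonal. *)
Lemma cascade_tree S S' :
  cascade_subsystem form D P S -> cascade_subsystem form D P S' ->
  [\/ S = S', orthogonal_to_highest S S', orthogonal_to_highest S' S
    | forall a b, S a -> S' b -> form a b = 0].
Proof.
have uniq T b c : cascade_subsystem form D P T -> highest_root (T `&` P) b ->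
    highest_root (T `&` P) c -> b = c.
  move=> /cascade_face[fT _].
  exact: (highest_root_unique (face_root_system fT) (face_positive fT)).
move=> cS cS'; elim: cS S' cS' => [|S1 b1 C cS1 IH1 hb1 compC] S' cS'.
  elim: cS' => [|S2 b2 C' cS2 IH2 hb2 [CT _ _]]; first by constructor 1.
  constructor 3 => b hb a /CT[S2a ab2]; case: IH2 => [ES|D2|S2D|orth].
  - by rewrite -ES in hb2 S2a; rewrite (uniq _ _ _ (cascade_top _ _ _) hb hb2).
  - have [[S2b2 _] _] := hb2; have Db2 := face_sub (cascade_face cS2).1 S2b2.
    have := D2 _ hb2 b2 Db2 => -[_ b20].
    by have := roots_pos rsD Db2; rewrite b20 ltxx.
  - exact: S2D hb _ S2a.
  - have Da := face_sub (cascade_face cS2).1 S2a.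
    by have := roots_pos rsD Da; rewrite orth // ltxx.
have cC := cascade_next cS1 hb1 compC; have [CT irrC Corth] := compC.
have [[S1b1 _] _] := hb1; have Db1 := face_sub (cascade_face cS1).1 S1b1.
elim: cS' => [|S2 b2 C' cS2 IH2 hb2 compC'].
  constructor 2 => b hb a /CT[S1a ab1].
  case: (IH1 _ (cascade_top _ _ _)) => [E|S1D|DS1|orth].
  - by rewrite E in hb1 S1a; rewrite (uniq _ _ _ (cascade_top _ _ _) hb hb1).
  - exact: S1D hb _ S1a.
  - have [_ b0] := DS1 _ hb1 b1 Db1.
    by have := roots_pos rsD Db1; rewrite b0 ltxx.
  - by have := roots_pos rsD Db1; rewrite orth // ltxx.
have cC' := cascade_next cS2 hb2 compC'; have [CT' irrC' Corth'] := compC'.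
case: (IH1 _ cC') => [E|S1C'|C'S1|orth].
- constructor 2 => b hb a /CT[S1a ab1]; rewrite -E in hb *.
  by rewrite (uniq _ _ _ cS1 hb hb1).
- by constructor 2 => b hb a /CT[S1a _]; apply: S1C' S1a.
- case: IH2 => [E|CS2|S2C|orth].
  + constructor 3 => b hb a /CT'[S2a ab2]; rewrite E in hb *.
    by rewrite (uniq _ _ _ cS2 hb hb2).
  + have [meet|disj] := pselect (exists2 a, C a & C' a); last first.
      constructor 4 => a b Ca C'b; apply: Corth => //; split.
        exact: C'S1 hb1 _ C'b.
      by move=> Cb; apply: disj; exists b.
    have inter X Y Z : irreducible_system form X -> X `<=` Z ->
        irreducible_component form Z Y -> (exists2 a, X a & Y a) -> X `<=` Y.
      move=> [_ irrX] XZ [_ _ Yorth] [a Xa Ya].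
      case: (irrX (X `&` Y) (X `\` Y)) => [|x y [_ Yx] [Xy nYy]|/seteqP[E _]|].
      * apply/seteqP; split=> [x Xx|x [[]//|[]//]].
        by have [Yx|nYx] := pselect (Y x); [left|right].
      * by apply: Yorth => //; split=> //; apply: XZ.
      * by case: (E a).
      * move=> /seteqP[E _] x Xx; apply: contrapT => nYx; exact: (E x).
    constructor 1; apply/seteqP; split.
      apply: (inter _ _ _ irrC _ compC') meet.
      by move=> a Ca; apply: CS2 hb2 _ Ca.
    have [a Ca C'a] := meet; apply: (inter _ _ _ irrC' _ compC); last by exists a.
    by move=> x C'x; apply: C'S1 hb1 _ C'x.
  + by constructor 3 => b hb a /CT'[S2a _]; apply: S2C S2a.
  + by constructor 4 => a b Ca /CT'[S2b _]; apply: orth.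
- by constructor 4 => a b /CT[S1a _]; apply: orth.
Qed.

Lemma cascade_pos b : kostant_cascade form D P b -> P b.
Proof. by case=> S _ [[]]. Qed.

Lemma cascade_finite : finite_set (kostant_cascade form D P).
Proof.
apply: sub_finite_set (roots_finite rsD) => b /cascade_pos.
exact: (pos_sub psP).
Qed.

Lemma cascade_orthogonal b c : kostant_cascade form D P b ->
  kostant_cascade form D P c -> b <> c -> form b c = 0.
Proof.
move=> [S cS hb] [S' cS' hc] neq.
have [[Sb _] _] := hb; have [[S'c _] _] := hc.
case: (cascade_tree cS cS') => [E|SS'|S'S|orth].
- rewrite -E in hc; case: neq; have [fS _] := cascade_face cS.
  exact: (highest_root_unique (face_root_system fS) (face_positive fS) hb hc).
- by have [] := SS' _ hc _ Sb.
- by rewrite formC; have [] := S'S _ hb _ S'c.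
- exact: orth.
Qed.

(** * Levels *)

Local Notation K := (kostant_cascade form D P).
Local Notation Kseq := (finmap.enum_fset (fset_set K)).

(** The pairing of [v] with half the sum of the cascade coroots, that is, its
    value at the cascade element. *)
Definition level (v : V) : F :=
  2%:R^-1 * \sum_(b \in K) form v (coroot form b).

Let levelE v : level v = 2%:R^-1 * \sum_(b <- Kseq) form v (coroot form b).
Proof. by rewrite /level fsbig_finite //; exact: cascade_finite. Qed.

Let mem_cascade b : reflect (K b) (b \in Kseq).
Proof. by rewrite in_fset_set; [exact: asboolP | exact: cascade_finite]. Qed.

Lemma levelD u v : level (u + v) = level u + level v.
Proof.
rewrite !levelE -mulrDr -big_split /=; congr (_ * _).
by apply: eq_bigr => b _; rewrite formDl.
Qed.

Lemma levelN v : level (- v) = - level v.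
Proof.
rewrite !levelE -mulrN -sumrN; congr (_ * _).
by apply: eq_bigr => b _; rewrite formNl.
Qed.

Lemma levelB u v : level (u - v) = level u - level v.
Proof. by rewrite levelD levelN. Qed.

Lemma level_sum (s : seq V) : level (\sum_(c <- s) c) = \sum_(c <- s) level c.
Proof.
elim: s => [|c s IHs]; last by rewrite !big_cons levelD IHs.
by rewrite !big_nil -(subrr 0) levelB subrr.
Qed.

Lemma level_cascade b : K b -> level b = 1.
Proof.
move=> Kb; rewrite levelE.
rewrite (big_rem b) /=; last exact/mem_cascade.
rewrite big_seq big1 => [|c]; last first.
  rewrite mem_rem_uniq ?finmap.fset_uniq // !inE => /andP[/eqP cb /mem_cascade Kc].
  by rewrite form_coroot (cascade_orthogonal Kb Kc (nesym cb)) mulr0.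
have bb := roots_pos rsD (pos_sub psP (cascade_pos Kb)).
by rewrite form_coroot addr0 divfK ?gt_eqF // mulVf // pnatr_eq0.
Qed.

Lemma cascade_complement a : P a -> ~ K a -> exists S b,
  [/\ cascade_subsystem form D P S, highest_root (S `&` P) b, S a,
      0 < form b a & (S `&` P) (b - a)].
Proof.
move=> Pa nKa; have [S [b [cS hb Sa ab]]] := cascade_attached Pa.
have [fS _] := cascade_face cS.
have rsS := face_root_system fS; have psS := face_positive fS.
have ba : 0 < form b a.
  by rewrite lt0r formC; apply/andP; split; [apply/eqP | rewrite formC];
    last exact: (highest_dominant rsS psS hb).
have neq : a <> b by move=> ab0; apply: nKa; rewrite ab0; exists S.
exists S, b; split=> //.
exact: (highest_root_diff rsS psS hb (conj Sa Pa) ba neq).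
Qed.

(** The root [b] is the highest root of the subsystem in which [a] fails to be
    orthogonal to the highest root. *)
Lemma level_complement a : P a -> ~ K a -> exists b,
  [/\ K b, P (b - a) & level (b - a) = 1 - level a].
Proof.
move=> Pa nKa; have [S [b [cS hb Sa ba [_ Pba]]]] := cascade_complement Pa nKa.
by exists b; split=> //; rewrite ?levelB ?(level_cascade (b := b)) //; exists S.
Qed.

(** The root [d1] belongs to a subsystem [S] of highest root [b], and [b] accounts
    for at most [2] of the sum [4] of the pairings of [d1] with the cascade
    coroots; so [(d1, c) > 0] for another cascade root [c], whose subsystem [S']
    is orthogonal to [b].  The root [d1 - c] is positive of level [1].  If
    [(d2, c) < 0], the decomposition is [(d1 - c) + (d2 + c)].  Otherwise
    [(d, c) > 0] and it is [c + (d - c)]: were [d] equal to [c] or [c - d]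
    positive, [d], and then its summand [d1], would be in the face [S'], although
    [d1] is not orthogonal to [b]. *)
Lemma level_split d d1 d2 : P d1 -> P d2 -> P d -> d = d1 + d2 ->
  level d1 = 2%:R -> level d2 = - 1 ->
  exists e f, [/\ P e, P f, d = e + f, level e = 1 & level f = 0].
Proof.
move=> P1 P2 Pd dE l1 l2.
have nK1 : ~ K d1.
  by move=> /level_cascade/eqP; rewrite l1 -[1]/(1%:R) eqr_nat.
have [S [b [cS hb S1 b1 [Sd Pd']]]] := cascade_complement P1 nK1.
have [fS _] := cascade_face cS.
have rsS := face_root_system fS; have psS := face_positive fS.
have Kb : K b by exists S.
have [[Sb Pb] _] := hb.
have bb := roots_pos rsD (pos_sub psP Pb).
have real x y : P x -> P y -> form x y \is Num.real.
  by move=> Px Py; apply: (roots_real rsD); exact: (pos_sub psP).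
have [c [Kc cb d1c]] : exists c, [/\ K c, c <> b & 0 < form d1 c].
  have bound : form d1 (coroot form b) <= 2%:R.
    rewrite form_coroot mulrAC ler_pdivrMr // ler_pM2l ?ltr0n // -subr_ge0 -formBl.
    by rewrite formC (highest_dominant rsS psS hb).
  have [||c cK] := @sum_gt0_exists F V (rem b Kseq)
      (fun c => form d1 (coroot form c)).
  - move=> c; rewrite mem_rem_uniq ?finmap.fset_uniq // !inE => /andP[_ /mem_cascade Kc].
    have Pc := cascade_pos Kc.
    by rewrite form_coroot realM ?real // ger0_real // divr_ge0 ?ler0n ?ltW //;
      apply: (roots_pos rsD); exact: (pos_sub psP).
  - have tot : \sum_(c <- Kseq) form d1 (coroot form c) = 4%:R.
      move: l1; rewrite levelE => /(canRL (mulKf _)) ->; last by rewrite invr_eq0 pnatr_eq0.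
      by rewrite invrK -natrM.
    have -> : \sum_(c <- rem b Kseq) form d1 (coroot form c)
        = 4%:R - form d1 (coroot form b).
      by rewrite -tot [in RHS](big_rem b) /=; [rewrite addrAC subrr add0r | exact/mem_cascade].
    by rewrite subr_gt0; apply: le_lt_trans bound _; rewrite ltr_nat.
  move: cK; rewrite mem_rem_uniq ?finmap.fset_uniq // !inE => /andP[/eqP cb /mem_cascade Kc].
  have cc := roots_pos rsD (pos_sub psP (cascade_pos Kc)).
  rewrite form_coroot pmulr_rgt0 ?divr_gt0 ?ltr0n // => d1c.
  by exists c.
have [S' cS' hc] := Kc; have [[S'c Pc] _] := hc; have [fS' _] := cascade_face cS'.
have S'orth : orthogonal_to_highest S' S.
  case: (cascade_tree cS cS') => // [E|SS'|orth].
  - rewrite -E in hc; case: cb.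
    exact: (highest_root_unique rsS psS hc hb).
  - by have [_ d1c0] := SS' _ hc _ S1; rewrite d1c0 ltxx in d1c.
  - by rewrite orth // ltxx in d1c.
have nS'1 : ~ S' d1.
  by move=> /(S'orth _ hb)[_]; rewrite formC => b10; rewrite b10 ltxx in b1.
have [Sc cb0] := S'orth _ hb _ S'c.
have lc := level_cascade Kc.
have P1c : P (d1 - c).
  have neq : d1 <> c by move=> E; rewrite E in nS'1.
  have [//|Pc1] := pos_sub_acute rsD psP P1 Pc d1c neq.
  have Sc1 : S (c - d1) by apply: (face_diff fS) => //; apply: (pos_sub psP).
  have := highest_dominant rsS psS hb (conj Sc1 Pc1).
  by rewrite formBr [form b c]formC cb0 sub0r oppr_ge0 lt_geF.
have [d2c|d2c] := boolP (form d2 c < 0).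
  exists (d1 - c), (d2 + c); split=> //.
  - exact: (pos_add_obtuse rsD psP P2 Pc d2c).
  - by rewrite dE addrACA addNr addr0.
  - by rewrite levelB l1 lc; ring.
  - by rewrite levelD l2 lc addNr.
rewrite -real_leNgt ?real0 ?real // in d2c.
have dc : 0 < form d c by rewrite dE formDl ltr_wpDr.
have ld : level d = 1.
  by rewrite dE levelD l1 l2; ring.
have nS'd : ~ S' d.
  by rewrite dE => /(face_add fS' P1 P2)[].
have neq : d <> c by move=> E; rewrite E in nS'd.
have [Pdc|Pcd] := pos_sub_acute rsD psP Pd Pc dc neq.
  exists c, (d - c); split=> //; first by rewrite subrKC.
  by rewrite levelB ld lc subrr.
by case: nS'd; have [] := face_add fS' Pd Pcd (eq_ind_r S' S'c (subrKC d c)).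
Qed.

(** * The complement of the ideal *)

Section WeylElement.
Variable w : 'End(V).
Hypotheses (w_stable : forall a, D a -> D (w a)) (w_inj : injective w).
Hypothesis w_onto : forall a, D a -> exists2 c, D c & w c = a.

Let wN a : w (- a) = - w a. Proof. exact: linearN. Qed.
Let wD a b : w (a + b) = w a + w b. Proof. exact: linearD. Qed.
Let wB a b : w (a - b) = w a - w b. Proof. exact: linearB. Qed.

Let L i := [set a | P a /\ level a = i].

Hypothesis inv_w : inversion_set P w = L 1 `|` L 2%:R.

Let inverted a : P a -> P (- w a) <-> level a = 1 \/ level a = 2%:R.
Proof.
move=> Pa; split=> [PNwa|la].
  have : inversion_set P w a by split=> //; exists (- w a); rewrite ?opprK.
  by rewrite inv_w => -[[_]|[_]]; auto.
have : inversion_set P w a by rewrite inv_w; case: la => la; [left | right].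
by case=> _ [b Pb <-]; rewrite opprK.
Qed.

Let kept a : P a -> ~ (level a = 1 \/ level a = 2%:R) -> P (w a).
Proof.
move=> Pa nla; have [//|/(inverted Pa)//] := pos_or_opp psP (w_stable (pos_sub psP Pa)).
Qed.

(** If neither [a] nor [b - a] is inverted by [w], their sum [b] is not inverted
    either; but cascade roots have level [1].  So [a] or [b - a] has level [1] or
    [2], and these levels add up to [1]. *)
Lemma level_values a : P a ->
  [\/ level a = - 1, level a = 0, level a = 1 | level a = 2%:R].
Proof.
move=> Pa; have [/level_cascade|nKa] := pselect (K a); first by constructor 3.
have [b [Kb Pba lba]] := level_complement Pa nKa.
have [[la|la]|nla] := pselect (level a = 1 \/ level a = 2%:R);
  [by constructor 3 | by constructor 4|].
have [[lba1|lba2]|nlba] := pselect (level (b - a) = 1 \/ level (b - a) = 2%:R).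
- by constructor 2; rewrite -[level a](subKr 1) -lba lba1 subrr.
- by constructor 1; rewrite -[level a](subKr 1) -lba lba2; ring.
have Pwb : P (w b).
  have -> : w b = w a + w (b - a) by rewrite -wD subrKC.
  apply: (pos_add psP); [exact: kept | exact: kept |].
  by rewrite -wD subrKC; apply/w_stable/(pos_sub psP)/cascade_pos.
have Pb := cascade_pos Kb.
by case: (pos_oppF psP Pwb); apply/(inverted Pb); left; apply: level_cascade.
Qed.

Let I := (w @` L (- 1)) `|` (w @` oppset (L 2%:R)).

Let one_neq_two : (1 : F) <> 2%:R.
Proof. by move=> /eqP; rewrite -[1]/(1%:R) eqr_nat. Qed.

Let complement1 a : P a -> level a = 1 -> (P `\` I) (- w a).
Proof.
move=> Pa la; split; first by apply/(inverted Pa); left.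
case=> [[c [Pc _]]|[c [d [Pd ld] <-]]].
  rewrite -wN => /w_inj ca; apply: (pos_oppF psP Pa).
  by rewrite -ca.
by rewrite -wN => /w_inj/oppr_inj da; apply: one_neq_two; rewrite -ld da la.
Qed.

Let complement_cases c : (P `\` I) c -> exists2 a, P a &
  (level a = 0 /\ c = w a) \/ (level a = 1 /\ c = - w a).
Proof.
move=> [Pc nIc]; have [a Da wa] := w_onto (pos_sub psP Pc).
have [Pa|PNa] := pos_or_opp psP Da.
  exists a => //; left; split=> //.
  have nla : ~ (level a = 1 \/ level a = 2%:R).
    by move=> /(inverted Pa); rewrite wa => /(pos_oppF psP Pc).
  case: (level_values Pa) => // la; try by case: nla; auto.
  by case: nIc; left; exists a; first by split.
exists (- a) => //; right; rewrite wN wa opprK; split=> //.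
have : level (- a) = 1 \/ level (- a) = 2%:R.
  by apply/(inverted PNa); rewrite wN opprK wa.
case=> // la; case: nIc; right; exists a => //; exists (- a) => //.
by rewrite opprK.
Qed.

(** In other words, [w] maps the cascade element to an antidominant one, and its
    inverse sends to positive roots the positive roots that vanish there. *)
Lemma level_preimage a : D a -> P (w a) ->
  level a <= 0 /\ (level a = 0 -> P a).
Proof.
move=> Da Pwa; have [Pa|PNa] := pos_or_opp psP Da.
  have nla : ~ (level a = 1 \/ level a = 2%:R).
    by move=> /(inverted Pa) /(pos_oppF psP Pwa).
  split=> //; case: (level_values Pa) => la; rewrite la ?oppr_le0 ?ler01 //.
    by case: nla; left.
  by case: nla; right.
have : level (- a) = 1 \/ level (- a) = 2%:R.
  by apply/(inverted PNa); rewrite wN opprK.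
rewrite levelN => la; split.
  by rewrite -oppr_ge0; case: la => ->; rewrite ?ler01 ?ler0n.
by move=> l0; move: la; rewrite l0 oppr0 => -[] /eqP; rewrite eq_sym ?oner_eq0 ?pnatr_eq0.
Qed.

Let B := simple_roots P.

Let not_maximal c a : (P `\` I) c -> P a -> level a = 1 -> P (- w a - c) ->
  ~ maximal_elements B (P `\` I) c.
Proof.
move=> cC Pa la Pd [_ maxc].
have le_c : root_le B c (- w a) := root_le_sub rsD psP Pd.
apply: (pos_neq0 rsD psP Pd).
by rewrite (maxc _ (complement1 Pa la) le_c) subrr.
Qed.

(** In the first half, a non-maximal element of the complement is exhibited below
    an element [- w e], with [e] of level [1].  In the second, [b] is an element of
    the complement above [- w a]: comparing levels, [b] is [- w e] with [e] of
    level [1], and [b + w a] is the image under [w] of a sum of positive roots, all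
    of level [0]; added to [e], they give the simple root [a], so there are
    none. *)
Theorem maximal_complement :
  maximal_elements B (P `\` I) = oppset (w @` (B `&` L 1)).
Proof.
apply/seteqP; split=> [c maxc|c0 [_ [a [Ba [Pa la]] <-] <-]].
  have cC : (P `\` I) c := maxc.1.
  have [a Pa [[la cE]|[la cE]]] := complement_cases cC.
    have nKa : ~ K a by move=> /level_cascade/eqP; rewrite la eq_sym oner_eq0.
    have [b [Kb Pba lba]] := level_complement Pa nKa.
    case: (not_maximal cC Pba _ _ maxc); first by rewrite lba la subr0.
    rewrite cE wB opprB addrAC subrr add0r.
    by apply/(inverted (cascade_pos Kb)); left; apply: level_cascade.
  have [sa|nsa] := pselect (B a); first by exists (w a) => //; exists a.
  (* The levels of [a1] and [a2] add up to [1]: they are [0], [1] or [-1], [2]. *)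
  have [a1 [a2 [P1 P2 aE]]] := nsimple_split Pa nsa.
  have [e [f [Pe Pf ef le lf]]] :
      exists e f, [/\ P e, P f, a = e + f, level e = 1 & level f = 0].
    have sum1 : level a1 + level a2 = 1 by rewrite -levelD -aE.
    have l2E : level a2 = 1 - level a1 by rewrite -sum1 addrAC subrr add0r.
    case: (level_values P1) => l1; rewrite l1 in l2E.
    - apply: (level_split P2 P1 Pa) => //; first by rewrite addrC.
      by rewrite l2E; ring.
    - by exists a2, a1; split=> //; rewrite ?l2E ?subr0 // addrC.
    - by exists a1, a2; split=> //; rewrite l2E subrr.
    - apply: (level_split P1 P2 Pa) => //.
      by rewrite l2E; ring.
  case: (not_maximal cC Pe le _ maxc).
  rewrite cE opprK ef wD addrA addNr add0r.
  apply: kept => //; rewrite lf => -[]/eqP; first by rewrite eq_sym oner_eq0.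
    by rewrite eq_sym pnatr_eq0.
split; first exact: complement1.
move=> b bC [s Bs sE].
have Ds c : c \in s -> exists2 d, D d & w d = c.
  by move=> /Bs/(simple_pos)/(pos_sub psP)/w_onto.
have [u uE Du] : exists2 u, map w u = s & forall d, d \in u -> D d.
  elim: (s) Ds => [|c s' IHs] Ds; first by exists [::].
  have [u uE Du] := IHs (fun d ds => Ds d (mem_behead (s := c :: s') ds)).
  have [d Dd dE] := Ds c (mem_head _ _).
  by exists (d :: u) => [|d']; [rewrite /= dE uE | rewrite inE => /predU1P[->|/Du]].
have Pwu d : d \in u -> P (w d).
  by move=> du; apply: simple_pos; apply: Bs; rewrite -uE map_f.
have sumE : b + w a = w (\sum_(d <- u) d).
  by move: sE; rewrite opprK => ->; rewrite -uE big_map linear_sum.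
have lu d : d \in u -> level d <= 0.
  by move=> du; have [] := level_preimage (Du d du) (Pwu d du).
have lsum : \sum_(d <- u) level d <= 0 by rewrite big_seq sumr_le0.
have [e Pe [[le bE]|[le bE]]] := complement_cases bC.
  move: sumE; rewrite bE -wD => /w_inj/(congr1 level).
  rewrite level_sum levelD le la add0r => l1.
  by move: lsum; rewrite -l1 ler10.
move: sumE; rewrite bE addrC -wB => /w_inj acE.
have lu0 d : d \in u -> level d = 0.
  move/(congr1 level): (acE); rewrite levelB le la subrr level_sum => /esym/eqP.
  rewrite big_seq -oppr_eq0 -sumrN psumr_eq0; last by move=> d' /lu; rewrite oppr_ge0.
  by move=> /allP H du; move: (H _ du); rewrite du oppr_eq0 => /eqP.
have Pu d : d \in u -> P d.
  by move=> du; have [_] := level_preimage (Du d du) (Pwu d du); apply; apply: lu0.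
case: u acE {uE Du Pwu lsum lu lu0} Pu => [|d u] acE Pu.
  by move: acE; rewrite big_nil => /eqP; rewrite subr_eq0 => /eqP->.
have aE : a = e + \sum_(d <- d :: u) d by rewrite -acE subrKC.
by case: (@simple_not_sum _ _ rsD psP a e (d :: u)).
Qed.

End WeylElement.
End Cascade.

(** * Weyl group elements *)

Section WeylGroup.
Variable D : set V.
Hypothesis rsD : root_system D.
Hypothesis refl_stable :
  forall a b, D a -> D b -> D (b - form b (coroot form a) *: a).

Lemma reflectionE a v : reflection form a v = v - form v (coroot form a) *: a.
Proof.
pose f u := u - form u (coroot form a) *: a.
have lin : linear f.
  move=> k u u'; rewrite /f formDl (form_scalel formP) scalerDl -scalerA.
  by rewrite scalerBr opprD addrACA.
pose fl : {linear V -> V} := HB.pack f (GRing.isLinear.Build _ _ _ _ f lin).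
exact: (lfunE fl v).
Qed.

Lemma reflectionK a : D a -> involutive (reflection form a).
Proof.
move=> Da v; have aa : form a a != 0 by rewrite gt_eqF // (roots_pos rsD).
have fa : form a (coroot form a) = 2%:R by rewrite form_coroot divfK.
rewrite !reflectionE formBl (form_scalel formP) fa.
set k := form v _; rewrite -addrA -opprD -scalerDl.
by rewrite (_ : k + (k - k * 2%:R) = 0) ?scale0r ?subr0 //; ring.
Qed.

Lemma weyl_bijective w : weyl_group form D w ->
  [/\ forall a, D a -> D (w a), injective w
    & forall a, D a -> exists2 c, D c & w c = a].
Proof.
elim=> [|a u Da _ [stab inj onto]].
  split=> [a|a b|a Da]; rewrite ?id_lfunE //.
  by exists a => //; rewrite id_lfunE.
have Drefl b : D b -> D (reflection form a b).
  by rewrite reflectionE => Db; apply: refl_stable.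
split=> [b Db|b c|b Db]; rewrite ?comp_lfunE.
- exact/Drefl/stab.
- by move=> /(can_inj (reflectionK Da))/inj.
- have [c Dc uc] := onto _ (Drefl _ Db); exists c => //.
  by rewrite comp_lfunE uc reflectionK.
Qed.

End WeylGroup.

End RootSystem.

(** * Simultaneous diagonalization and traces *)

Import passmx.

(** The matrix form of this statement is carried over through coordinates. *)
Lemma codiagonalizable_basis (F : fieldType) (V : vectType F) (fs : seq 'End(V)) :
  (forall f h, f \in fs -> h \in fs -> (f \o h = h \o f)%VF) ->
  (forall f, f \in fs -> exists e : seq V, basis_of fullv e /\
     forall x, x \in e -> exists c : F, f x = c *: x) ->
  exists2 e : (\dim {:V}).-tuple V, basis_of fullv e &
    forall f, f \in fs -> forall i : 'I_(\dim {:V}), exists c : F, f e`_i = c *: e`_i.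
Proof.
move=> comm diag; pose vb := vbasis {:V}; have vbP : basis_of fullv vb := vbasisP _.
have unit_mxof (e : (\dim {:V}).-tuple V) : basis_of fullv e ->
    mxof e vb \1 \in unitmx.
  move=> eP; apply: (proj1 (mulmx1_unit (B := mxof vb e \1) _)).
  by rewrite -mxof_comp // comp_lfun1l mxof1 // (basis_free eP).
have [P Pu /allP/= PD] : codiagonalizable [seq mxof vb vb f | f <- fs].
  apply/codiagonalizableP; split=> [A B /mapP[f ff ->] /mapP[h hf ->]|A /mapP[f ff ->]].
    by rewrite /comm_mx -!mxof_comp // comm.
  have [e0 [e0P e0D]] := diag f ff.
  have sz : size e0 == \dim {:V} by rewrite (size_basis (X := in_tuple e0) e0P).
  pose e := Tuple sz; have eP : basis_of fullv e := e0P.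
  exists (mxof e vb \1); first exact: unit_mxof.
  apply/diagonalizable_forP => [|i j ij]; first exact: unit_mxof.
  rewrite -mxof_comp // comp_lfun1r -[f in mxof e vb f]comp_lfun1l.
  rewrite (mxof_comp _ _ eP) mulmxK ?unit_mxof // !mxE vecof_delta.
  have [c ->] : exists c, f e`_i = c *: e`_i.
    by apply/e0D/mem_nth; rewrite (eqP sz).
  rewrite linearZ /= coord_free ?(basis_free eP) // -val_eqE (negPf ij) mulr0 //.
pose f := hommx vb vb P.
have kerf : lker f == 0%VS.
  apply/lker0P; apply: (can_inj (g := hommx vb vb (invmx P))) => v.
  by rewrite -comp_lfunE -hommx_mul // mulmxV // hommx1 ?id_lfunE.
have fE (i : 'I_(\dim {:V})) : f vb`_i = vecof vb (row i P).
  by rewrite hommxE // rVofE ?(basis_free vbP) // -rowE.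
exists (map_tuple f vb).
  have := limg_basis_of (f := f) (U := fullv) (X := vb).
  by rewrite lker0_limgf // (eqP kerf) capv0; apply.
move=> h hf i; have := PD _ (map_f (mxof vb vb) hf).
move=> /(diagonalizable_forLR Pu)[d hE].
exists (d 0 i); rewrite (nth_map 0) ?size_tuple // fE (hom_vecof _ vbP) -row_mul hE.
by rewrite mxpoly.conjVmx // !mulmxA mulmxV // mul1mx row_mul row_diag_mx -scalemxAl -rowE linearZ.
Qed.

Lemma lfun_trace_basis (F : fieldType) (g : lieAlgType F)
    (e : (\dim {:g}).-tuple g) (f : 'End(g)) :
  basis_of fullv e -> lfun_trace f = \sum_i coord e i (f e`_i).
Proof.
move=> eP; rewrite /lfun_trace; set vb := vbasis _.
have vbP : basis_of fullv vb := vbasisP _.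
rewrite -[f in LHS]comp_lfun1r (mxof_comp _ _ eP) mxtrace_mulC -mxof_comp //.
by rewrite comp_lfun1l; apply: eq_bigr => i _; rewrite !mxE vecof_delta.
Qed.

Lemma lfun_trace_mulC (F : fieldType) (g : lieAlgType F) (f h : 'End(g)) :
  lfun_trace (f \o h)%VF = lfun_trace (h \o f)%VF.
Proof. by rewrite /lfun_trace !(mxof_comp _ _ (vbasisP _)) mxtrace_mulC. Qed.

(** * Brackets and the Killing form *)

Section Brackets.
Variables (F : fieldType) (g : lieAlgType F).
Implicit Types x y z : g.

HB.instance Definition _ x :=
  GRing.isLinear.Build F g g _ (lie_bracket x) (lie_bracket_linearr x).

Lemma bracketDl x y z : [< x + y, z >] = [< x, z >] + [< y, z >].
Proof. by have := lie_bracket_linearl z 1 x y; rewrite /= !scale1r. Qed.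

Lemma bracket0l x : [< 0 : g, x >] = 0.
Proof. by apply: (addrI [< 0, x >]); rewrite -bracketDl !addr0. Qed.

Lemma bracketZl k x y : [< k *: x, y >] = k *: [< x, y >].
Proof.
by have := lie_bracket_linearl y k x 0; rewrite /= bracket0l !addr0.
Qed.

Lemma bracket_suml (I : Type) (r : seq I) (f : I -> g) y :
  [< \sum_(i <- r) f i, y >] = \sum_(i <- r) [< f i, y >].
Proof.
elim: r => [|i r IHr]; first by rewrite !big_nil bracket0l.
by rewrite !big_cons bracketDl IHr.
Qed.

Lemma bracketC x y : [< x, y >] = - [< y, x >].
Proof.
have := lie_bracketxx (x + y).
rewrite bracketDl !linearD /= !lie_bracketxx add0r addr0 => /eqP.
by rewrite addr_eq0 => /eqP.
Qed.

(** The Jacobi identity: [[< x, _ >]] is a derivation. *)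
Lemma bracket_derivation x y z :
  [< x, [< y, z >] >] = [< [< x, y >], z >] + [< y, [< x, z >] >].
Proof.
have /eqP := lie_jacobi x y z; rewrite addrAC addr_eq0 => /eqP.
rewrite [[< z, _ >]]bracketC [[< z, x >]]bracketC linearN /=.
by move=> E; rewrite -[LHS](addrK (- [< [< x, y >], z >])) E opprK opprK addrC.
Qed.

Lemma adE x y : ad x y = [< x, y >].
Proof. exact: lfunE. Qed.

Lemma killingC x y : killing x y = killing y x.
Proof. exact: lfun_trace_mulC. Qed.

Lemma killing_basis (e : (\dim {:g}).-tuple g) x y : basis_of fullv e ->
  killing x y = \sum_i coord e i [< x, [< y, e`_i >] >].
Proof.
move=> eP; rewrite /killing (lfun_trace_basis _ eP).
by apply: eq_bigr => i _; rewrite comp_lfunE !adE.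
Qed.

Lemma killing_linearl y : linear (fun x => killing x y : F^o).
Proof.
have eP : basis_of fullv (vbasis {:g}) := vbasisP _.
move=> k x x'; rewrite /= !(killing_basis _ _ eP) scaler_sumr -big_split /=.
by apply: eq_bigr => i _; rewrite bracketDl bracketZl linearP.
Qed.

Lemma killing_linearr x : linear (killing x : g -> F^o).
Proof. by move=> k y y'; rewrite !(killingC x) killing_linearl. Qed.

HB.instance Definition _ x :=
  GRing.isLinear.Build F g F^o _ (killing x : g -> F^o) (killing_linearr x).

Lemma killing_invariant x y z : killing [< x, y >] z = killing x [< y, z >].
Proof.
have tr f h : lfun_trace (f - h : 'End(g)) = lfun_trace f - lfun_trace h.
  by rewrite /lfun_trace linearB /= raddfB.
have adB (u v : g) : ad [< u, v >] = ((ad u \o ad v) - (ad v \o ad u))%VF.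
  apply/lfunP => w. rewrite add_lfunE opp_lfunE !comp_lfunE !adE.
  by rewrite bracket_derivation addrK.
rewrite /killing !adB comp_lfunDl comp_lfunDr comp_lfunNl comp_lfunNr !tr.
rewrite !comp_lfunA; congr (_ - _).
by rewrite -(comp_lfunA (ad y)); apply: lfun_trace_mulC.
Qed.

End Brackets.

(** * Weights *)

Section Weights.
Variables (F : numFieldType) (g : lieAlgType F) (t : {vspace g}).
Local Notation dual := (cartan_dual t).
Implicit Types (a b : dual) (h : subvs_of t).

Definition weight_vector a (x : g) : Prop :=
  forall h, [< vsval h, x >] = a h *: x.

Lemma weight_bracket a b x y : weight_vector a x -> weight_vector b y ->
  weight_vector (a + b) [< x, y >].
Proof.
move=> ax by_ h; rewrite bracket_derivation ax by_ bracketZl linearZ /=.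
by rewrite add_lfunE scalerDl.
Qed.

Lemma weight_basis_exists : cartan_subalgebra t ->
  exists (e : (\dim {:g}).-tuple g) (l : 'I_(\dim {:g}) -> dual),
    basis_of fullv e /\ forall i, weight_vector (l i) e`_i.
Proof.
move=> [comm _ diag]; have tP : basis_of t (vbasis t) := vbasisP t.
have [|_ /mapP[u ut ->]|e eP eD] :=
    @codiagonalizable_basis F g [seq ad u | u <- vbasis t].
- move=> _ _ /mapP[u ut ->] /mapP[v vt ->]; apply/lfunP => x.
  rewrite !comp_lfunE !adE bracket_derivation.
  by rewrite (comm u v) ?(basis_mem tP) // bracket0l add0r.
- have [e0 [e0P e0D]] := diag u (basis_mem tP ut).
  by exists e0; split=> // x /e0D[c cE]; exists c; rewrite adE.
have lin i : linear (fun h : subvs_of t => coord e i [< vsval h, e`_i >] : F^o).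
  by move=> k h h'; rewrite linearP /= bracketDl bracketZl linearP.
pose lf i : {linear subvs_of t -> F^o} :=
  HB.pack (fun h : subvs_of t => coord e i [< vsval h, e`_i >] : F^o)
    (GRing.isLinear.Build _ _ _ _ _ (lin i)).
exists e, (fun i => linfun (lf i)); split=> // i h; rewrite lfunE /=.
have [c cE] : exists c, [< vsval h, e`_i >] = c *: e`_i.
  rewrite (coord_basis tP (subvsP h)) bracket_suml.
  have /choice[c cE] : forall k : 'I_(\dim t), exists c, [< (vbasis t)`_k, e`_i >] = c *: e`_i.
    move=> k; have [c] := eD _ (map_f (@ad F g) (mem_nth 0 (s := vbasis t)
      (n := k) (ltac:(by rewrite size_tuple ltn_ord)))) i.
    by rewrite adE; exists c.
  exists (\sum_k coord (vbasis t) k (vsval h) * c k).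
  by rewrite scaler_suml; apply: eq_bigr => k _; rewrite bracketZl cE scalerA.
rewrite cE linearZ /= coord_free ?(basis_free eP) // eqxx mulr1 //.
Qed.

Variables (e : (\dim {:g}).-tuple g) (l : 'I_(\dim {:g}) -> dual).
Hypotheses (eP : basis_of fullv e) (eW : forall i, weight_vector (l i) e`_i).

Let coord_e (i j : 'I_(\dim {:g})) : coord e i e`_j = (i == j)%:R.
Proof. by rewrite coord_free ?(basis_free eP) // eq_sym. Qed.

Lemma coord_bracket i h x : coord e i [< vsval h, x >] = l i h * coord e i x.
Proof.
rewrite [in LHS](coord_basis eP (memvf x)) linear_sum linear_sum (bigD1 i) //=.
rewrite linearZ /= eW !linearZ /= coord_e eqxx mulr1 mulrC big1 ?addr0 // => j ji.
by rewrite linearZ /= eW !linearZ /= coord_e eq_sym (negPf ji) !mulr0.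
Qed.

Lemma coord_weight a x i : weight_vector a x -> coord e i x != 0 -> l i = a.
Proof.
move=> ax xi; apply/lfunP => h; apply: (mulIf xi).
by rewrite -coord_bracket ax linearZ.
Qed.

Lemma weight_index a x : weight_vector a x -> x <> 0 -> exists i, l i = a.
Proof.
move=> ax x0; apply: contrapT => nol; apply: x0.
rewrite (coord_basis eP (memvf x)) big1 // => i _.
have [->|xi] := eqVneq (coord e i x) 0; first by rewrite scale0r.
by case: nol; exists i; apply: coord_weight xi.
Qed.

Lemma basis_neq0 (i : 'I_(\dim {:g})) : e`_i <> 0.
Proof. by move=> ei; have := coord_e i i; rewrite ei linear0 eqxx => /eqP; rewrite eq_sym oner_eq0. Qed.

Lemma lie_rootsE : lie_roots t = [set a : dual | a <> 0 /\ exists i, l i = a].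
Proof.
(* In [lie_roots], the zero is that of functions rather than of linear maps. *)
have fct0 a : (fun_of_lfun a = (fun=> 0)) <-> a = 0.
  split=> [E|->]; first by apply/lfunP => h; rewrite E zero_lfunE.
  by apply/funext => h; rewrite zero_lfunE.
apply/seteqP; split=> a [a0].
  move=> [x x0 ax]; split; last exact: (weight_index ax x0).
  by move/fct0.
move=> [i lE]; split; first by move/fct0.
by exists e`_i; rewrite -?lE; [exact: basis_neq0 | exact: eW].
Qed.

Lemma roots_are_finite : finite_set (lie_roots t).
Proof.
apply: (sub_finite_set (B := range l)); last exact: finite_image.
by rewrite lie_rootsE => a [_ [i <-]]; exists i.
Qed.

(** In characteristic zero the vectors [b + a *+ p] are distinct, and weights are
    finitely many. *)
Lemma string_bounded a b : a <> 0 ->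
  exists p, forall v, weight_vector (b + a *+ p) v -> v = 0.
Proof.
move=> a0; apply: contrapT => /forallNP nop.
have /choice[f fE] : forall p : 'I_(\dim {:g}).+1, exists i, l i = b + a *+ p.
  by move=> p; have /existsNP[v /not_implyP[bv v0]] := nop p; apply: weight_index bv v0.
have f_inj : injective f.
  move=> p q pq; apply/val_inj/eqP => /=; have := fE p; rewrite pq fE => /addrI/eqP.
  rewrite -!scaler_nat -subr_eq0 -scalerBl scaler_eq0 subr_eq0 eqr_nat eq_sym.
  by case/orP => // /eqP.
by have := leq_card f f_inj; rewrite !card_ord ltnn.
Qed.

Lemma iter_nilpotent a b x v : a <> 0 -> weight_vector a x ->
    weight_vector b v -> v <> 0 ->
  exists p, iter p (lie_bracket x) v <> 0 /\ [< x, iter p (lie_bracket x) v >] = 0.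
Proof.
move=> a0 ax bv v0; have [N Nv] := string_bounded b a0.
have wv k : weight_vector (b + a *+ k) (iter k (lie_bracket x) v).
  elim: k => [|k IHk]; first by rewrite addr0.
  by rewrite mulrS addrCA; apply: weight_bracket.
have ex : exists k, iter k (lie_bracket x) v == 0 by exists N; apply/eqP/Nv/wv.
case: (ex_minnP ex) => -[|p] /eqP pE pmin; first by case: v0.
by exists p; split=> // E; have := pmin p; rewrite E eqxx ltnn => /(_ isT).
Qed.

(** The representation theory of sl2, in a form that also covers [a z = 0]: from a
    vector killed by [x], the powers of [y] produce vectors on which [x] acts by
    explicit scalars, and the first power that vanishes determines the weight. *)
Lemma root_string a b x y z v : a <> 0 -> weight_vector a x ->
    weight_vector (- a) y -> vsval z = [< x, y >] -> weight_vector b v ->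
    v <> 0 ->
  exists p m : nat, 2%:R * (b z + p%:R * a z) = m%:R * a z /\
    forall k, (k <= m)%N ->
      exists2 u, u <> 0 & weight_vector (b + a *+ p - a *+ k) u.
Proof.
move=> a0 ax ay zE bv v0.
have witer c d u s k : weight_vector c s -> weight_vector d u ->
    weight_vector (d + c *+ k) (iter k (lie_bracket s) u).
  move=> cs du; elim: k => [|k IHk]; first by rewrite addr0.
  by rewrite mulrS addrCA; apply: weight_bracket.
have [p [u0 xu]] := iter_nilpotent a0 ax bv v0.
set u := iter p _ v in u0 xu; have wu : weight_vector (b + a *+ p) u by apply: witer.
have Na0 : - a <> 0 by move=> /eqP; rewrite oppr_eq0 => /eqP.
have [m [ym0 yym]] := iter_nilpotent Na0 ay wu u0.
exists p, m; pose Y k := iter k (lie_bracket y) u.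
have wY k : weight_vector (b + a *+ p - a *+ k) (Y k).
  by rewrite -mulNrn; apply: witer.
have natE k z' : (a *+ k) z' = k%:R * a z' by rewrite -scaler_nat scale_lfunE.
have step k : [< x, Y k.+1 >] =
    (b z + p%:R * a z - k%:R * a z) *: Y k + [< y, [< x, Y k >] >].
  rewrite (_ : Y k.+1 = [< y, Y k >]) // bracket_derivation -zE wY; congr (_ *: _ + _).
  by rewrite !add_lfunE opp_lfunE !natE.
have xY k : 2%:R *: [< x, Y k.+1 >] =
    (k.+1%:R * (2%:R * (b z + p%:R * a z) - k%:R * a z)) *: Y k.
  elim: k => [|k IHk]; rewrite step scalerDr.
    by rewrite [[< x, Y 0%N >]]xu linear0 scaler0 addr0 scalerA; congr (_ *: _); ring.
  have yZ d u' : [< y, d *: u' >] = d *: [< y, u' >] by rewrite linearZ.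
  rewrite -yZ IHk yZ scalerA -[[< y, Y k >]]/(Y k.+1) -scalerDl.
  by congr (_ *: _); rewrite -!natr1; ring.
split; last first.
  move=> k km; exists (Y k) => // Yk0; apply: ym0.
  rewrite -(subnK km) iterD -/(Y k) Yk0.
  by elim: (m - k)%N => //= n ->; rewrite linear0.
have := xY m; rewrite [Y m.+1]yym linear0 scaler0 => /esym/eqP.
rewrite scaler_eq0 mulf_eq0 pnatr_eq0 /= => /orP[/eqP E|/eqP//].
by apply/eqP; rewrite -subr_eq0; apply/eqP.
Qed.

(** * The Killing form is nondegenerate *)

Hypotheses (simpleG : simple_lie g) (cartanT : cartan_subalgebra t).

Lemma weight0_cartan x : weight_vector 0 x -> x \in t.
Proof.
have [_ self _] := cartanT => x0; apply: self => u ut.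
by have := x0 (vsproj t u); rewrite vsprojK // zero_lfunE scale0r.
Qed.

Lemma cartan_weight0 h : weight_vector 0 (vsval h).
Proof.
have [comm _ _] := cartanT => k.
by rewrite comm ?subvsP // zero_lfunE scale0r.
Qed.

Lemma not_abelian : ~ (forall x y : g, [< x, y >] = 0).
Proof. by move=> ab; have [[x [y xy]] _] := simpleG; apply/xy/ab. Qed.

Lemma weight_nonzero : exists i, l i <> 0.
Proof.
apply: contrapT => nol; have [comm _ _] := cartanT.
suff all_t u : u \in t by apply: not_abelian => x y; apply: comm.
rewrite (coord_basis eP (memvf u)); apply: memv_suml => i _; apply: memvZ.
apply: weight0_cartan; suff <- : l i = 0 by [].
by apply: contrapT => li; apply: nol; exists i.
Qed.

Lemma bracket_basis0 x : (forall i : 'I_(\dim {:g}), [< x, e`_i >] = 0) ->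
  forall y, [< x, y >] = 0.
Proof.
move=> xe y; rewrite (coord_basis eP (memvf y)) linear_sum big1 // => i _.
by rewrite linearZ /= xe scaler0.
Qed.

(** Such an [h] is central, so the line it spans is an ideal. *)
Lemma cartan_separated h : (forall i, l i h = 0) -> h = 0.
Proof.
move=> lh; have hx x : [< vsval h, x >] = 0.
  by apply: bracket_basis0 => i; rewrite eW lh scale0r.
have idealh : lie_ideal <[vsval h]>.
  by move=> x _ /vlineP[c ->]; rewrite linearZ /= bracketC hx oppr0 scaler0 mem0v.
have [line0|linef] := simpleG.2 _ idealh.
  by apply/val_inj/eqP; rewrite /= -memv0 -line0 memv_line.
case: not_abelian => x y.
have /vlineP[c ->] : x \in <[vsval h]>%VS by rewrite linef memvf.
by rewrite bracketZl hx scaler0.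
Qed.

Lemma span_ideal (s : seq g) :
  (forall (i : 'I_(\dim {:g})) u, u \in s -> [< e`_i, u >] \in <<s>>%VS) ->
  lie_ideal <<s>>.
Proof.
move=> stab x y ys; rewrite (coord_basis eP (memvf x)) bracket_suml.
apply: memv_suml => i _; rewrite bracketZl memvZ //.
rewrite (coord_span (X := in_tuple s) ys) linear_sum.
apply: memv_suml => j _; rewrite linearZ memvZ //; apply: stab.
exact: mem_nth.
Qed.

Lemma span_coord0 (s : seq g) i : (forall u, u \in s -> coord e i u = 0) ->
  forall y, y \in <<s>>%VS -> coord e i y = 0.
Proof.
move=> s0 y ys; rewrite (coord_span (X := in_tuple s) ys) linear_sum big1 // => j _.
by rewrite linearZ /= s0 ?mulr0 // mem_nth.
Qed.

Lemma weight_span (s : seq g) a x : weight_vector a x ->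
  (forall i, l i = a -> e`_i \in s) -> x \in <<s>>%VS.
Proof.
move=> ax sa; rewrite (coord_basis eP (memvf x)); apply: memv_suml => i _.
have [->|xi] := eqVneq (coord e i x) 0; first by rewrite scale0r mem0v.
by rewrite memvZ // memv_span // sa // (coord_weight ax).
Qed.

Lemma killing_weights h k : killing (vsval h) (vsval k) = \sum_i l i h * l i k.
Proof.
rewrite (killing_basis _ _ eP); apply: eq_bigr => i _.
by rewrite !coord_bracket coord_e eqxx mulr1.
Qed.

(** The endomorphism whose trace is taken shifts weights by [a + b]. *)
Lemma killing_weight0 a b x y : weight_vector a x -> weight_vector b y ->
  a + b <> 0 -> killing x y = 0.
Proof.
move=> ax by_ ab; rewrite (killing_basis _ _ eP) big1 // => i _.
apply/eqP/negPn/negP => xi; apply: ab.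
have := coord_weight (weight_bracket ax (weight_bracket by_ (eW i))) xi.
by rewrite addrA => /esym/(canRL (addrK _)); rewrite subrr.
Qed.

Lemma killing_basis0 (x : g) : (forall i : 'I_(\dim {:g}), killing x e`_i = 0) ->
  forall y, killing x y = 0.
Proof.
move=> xe y; rewrite (coord_basis eP (memvf y)) linear_sum big1 // => i _.
by rewrite linearZ /= xe scaler0.
Qed.

Lemma string_ratio a x y z : a <> 0 -> weight_vector a x ->
    weight_vector (- a) y -> vsval z = [< x, y >] ->
  forall i, exists2 r : F, r \is Num.real & l i z = r * a z.
Proof.
move=> a0 ax ay zE i.
have [p [m [E _]]] := root_string a0 ax ay zE (eW i) (basis_neq0 (i := i)).
exists (m%:R / 2%:R - p%:R); first by rewrite realB ?realM ?realV ?realn.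
have n2 : (2%:R : F) != 0 by rewrite pnatr_eq0.
apply: (mulfI n2); move: E; rewrite mulrDr => /(canRL (addrK _)) ->.
by field.
Qed.

Lemma real_sq_sum_eq0 (I : finType) (r : I -> F) : (forall i, r i \is Num.real) ->
  \sum_i r i * r i = 0 -> forall i, r i = 0.
Proof.
move=> rr /eqP; rewrite psumr_eq0 => [|i _]; last by rewrite -expr2 real_exprn_even_ge0.
by move=> /allP H i; have := H i; rewrite mem_index_enum mulf_eq0 orbb => /(_ isT)/eqP.
Qed.

(** If the Killing form vanished, then [\sum_i (l i h) ^+ 2 = 0] for [h] in [t];
    on [h = [< x, y >]] the weights are real multiples of one of them, so they
    vanish and opposite root vectors commute.  The root vectors then span an
    ideal meeting [t] trivially. *)
Lemma killing_nonzero : ~ (forall x y : g, killing x y = 0).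
Proof.
move=> kill0.
have opp0 a x y : a <> 0 -> weight_vector a x -> weight_vector (- a) y ->
    x <> 0 -> [< x, y >] = 0.
  move=> a0 ax ay x0.
  have zt : [< x, y >] \in t.
    by apply: weight0_cartan; rewrite -(subrr a); apply: weight_bracket.
  pose z := vsproj t [< x, y >]; have zE : vsval z = [< x, y >] by rewrite vsprojK.
  rewrite -zE (_ : z = 0) //; apply: cartan_separated.
  have /choice[r rP] : forall i, exists r : F, r \is Num.real /\ l i z = r * a z.
    by move=> i; have [r] := string_ratio a0 ax ay zE i; exists r.
  have lz i : l i z = r i * a z by case: (rP i).
  have [az|az] := eqVneq (a z) 0; first by move=> i; rewrite lz az mulr0.
  have r0 : forall i, r i = 0.
    apply: real_sq_sum_eq0 => [i|]; first by case: (rP i).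
    have : (\sum_i r i * r i) * a z ^+ 2 = killing (vsval z) (vsval z).
      by rewrite killing_weights mulr_suml; apply: eq_bigr => i _; rewrite !lz; ring.
    by rewrite kill0 => /eqP; rewrite mulf_eq0 expf_eq0 (negPf az) orbF => /eqP.
  have [i li] := weight_index ax x0.
  by move: az; rewrite -li lz r0 mul0r eqxx.
pose s := [seq e`_(val i) | i <- enum 'I_(\dim {:g}) & l i != 0].
have s_mem i : l i <> 0 -> e`_i \in s.
  by move=> /eqP li; apply/mapP; exists i; rewrite // mem_filter li mem_enum.
have s_inv (u : g) : u \in s -> exists2 i, l i <> 0 & u = e`_(val i).
  case/mapP=> i; rewrite mem_filter => /andP[/eqP li _] ->.
  by exists i.
have ideals : lie_ideal <<s>>.
  apply: span_ideal => i u /s_inv[j lj ->].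
  have [lij|lij] := eqVneq (l i + l j) 0.
    have lE : l j = - l i by apply/eqP; rewrite -addr_eq0 addrC lij.
    rewrite (opp0 (l i)) ?mem0v //; last exact: basis_neq0.
      by move=> li; apply: lj; rewrite lE li oppr0.
    by rewrite -lE.
  apply: (weight_span (weight_bracket (eW i) (eW j))) => k lk; apply: s_mem.
  by rewrite lk; apply/eqP.
have [s0|sf] := simpleG.2 _ ideals.
  have [i /s_mem/memv_span] := weight_nonzero.
  by rewrite s0 memv0 => /eqP; apply: basis_neq0.
have t0 u : u \in t -> u = 0.
  move=> ut; rewrite (coord_basis eP (memvf u)) big1 // => i _.
  have [->|ui] := eqVneq (coord e i u) 0; first by rewrite scale0r.
  have li : l i = 0.
    by apply: coord_weight ui; rewrite -(vsprojK ut); apply: cartan_weight0.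
  case/eqP: ui; apply: (span_coord0 (s := s)); last by rewrite sf memvf.
  move=> v /s_inv[j lj ->]; rewrite coord_e.
  by have [ij|//] := eqVneq i j; case: lj; rewrite -ij.
apply: not_abelian => x y; have [_ self _] := cartanT.
have x0 : x = 0.
  by apply/t0/self => u /t0 ->; rewrite bracket0l.
by rewrite x0 bracket0l.
Qed.

(** The radical of the Killing form is an ideal. *)
Lemma killing_nondegenerate (x : g) : (forall y, killing x y = 0) -> x = 0.
Proof.
move=> x0.
pose I := (\bigcap_(i < \dim {:g}) lker (linfun (killing e`_i : g -> F^o)))%VS.
have memI (u : g) : u \in I <-> forall y, killing u y = 0.
  split=> [|u0].
    rewrite memvE => /subv_bigcapP uI; apply: killing_basis0 => i.
    have := uI i isT; rewrite -memvE memv_ker lfunE /= => /eqP.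
    by rewrite killingC.
  rewrite memvE; apply/subv_bigcapP => i _.
  by rewrite -memvE memv_ker lfunE /= killingC u0.
have idealI : lie_ideal I.
  move=> u v /memI v0; apply/memI => y.
  by rewrite bracketC -scaleN1r -bracketZl killing_invariant killingC linearZ /= killingC v0 scaler0.
have /memI xI := x0; have [I0|If] := simpleG.2 _ idealI.
  by apply/eqP; rewrite -memv0 -I0.
case: killing_nonzero => u v; have : u \in I by rewrite If memvf.
by move/memI.
Qed.

(** * The form on the dual of the Cartan subalgebra *)

(** [flat] is built from functions whose linearity has to be supplied. *)
Lemma flatE h k : flat t h k = killing (vsval h) (vsval k).
Proof.
have lin1 h' : linear (fun k : subvs_of t => killing (vsval h') (vsval k) : F^o).
  by move=> c u v; rewrite (linearP vsval); apply: killing_linearr.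
pose f1 h' : {linear subvs_of t -> F^o} :=
  HB.pack (fun k : subvs_of t => killing (vsval h') (vsval k) : F^o)
    (GRing.isLinear.Build _ _ _ _ _ (lin1 h')).
have lin2 : linear (fun h' : subvs_of t => linfun (f1 h') : dual).
  move=> c u v; apply/lfunP => k'; rewrite add_lfunE scale_lfunE !lfunE.
  exact: (killing_linearl (vsval k') c (vsval u) (vsval v)).
pose f2 : {linear subvs_of t -> dual} :=
  HB.pack (fun h' : subvs_of t => linfun (f1 h') : dual) (GRing.isLinear.Build _ _ _ _ _ lin2).
have -> : flat t h = linfun (f1 h) by exact: (lfunE f2 h).
exact: (lfunE (f1 h) k).
Qed.

Lemma flat_inj : lker (flat t) == 0%VS.
Proof.
rewrite -subv0; apply/subvP => h; rewrite memv_ker memv0 => /eqP h0.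
apply/eqP/val_inj; apply: killing_nondegenerate; apply: killing_basis0 => i.
have [li|li] := eqVneq (l i) 0.
  have it : e`_i \in t by apply: weight0_cartan; rewrite -li.
  by rewrite -(vsprojK it) -flatE h0 zero_lfunE.
by apply: killing_weight0 (cartan_weight0 h) (eW i) _; rewrite add0r; apply/eqP.
Qed.

Lemma flat_surj : limg (flat t) = fullv.
Proof.
apply/eqP; rewrite eqEdim subvf limg_dim_eq ?(eqP flat_inj) ?capv0 //= !dimvf.
by rewrite /dim /= muln1.
Qed.

Lemma sharpK a : flat t (sharp t a) = a.
Proof. by rewrite limg_lfunVK // flat_surj memvf. Qed.

Lemma flatK h : sharp t (flat t h) = h.
Proof. exact: lker0_lfunK flat_inj h. Qed.

Lemma dual_formE a b : dual_form t a b = a (sharp t b).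
Proof. by rewrite -[a in RHS]sharpK flatE. Qed.

Lemma dual_form_bilinear : symmetric_bilinear (dual_form t).
Proof.
split=> [a b|a b c|k a b]; first exact: killingC.
  by rewrite !dual_formE add_lfunE.
by rewrite !dual_formE scale_lfunE.
Qed.

(** * The roots form a root system *)

Local Notation form := (dual_form t).
Let formP := dual_form_bilinear.

Lemma opposite_vector i : l i <> 0 -> exists2 y, weight_vector (- l i) y &
  killing e`_i y <> 0.
Proof.
move=> li; apply: contrapT => noy.
apply: (@basis_neq0 i); apply: killing_nondegenerate; apply: killing_basis0 => j.
apply: contrapT => ij; apply: noy; exists e`_j => //.
suff -> : - l i = l j by [].
apply/eqP; rewrite eq_sym -addr_eq0 addrC; apply/negPn/negP => /eqP lij.
by apply: ij; apply: killing_weight0 (eW i) (eW j) lij.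
Qed.

(** By invariance, [[< e`_i, y >]] is a multiple of the element of [t] that
    represents [l i]. *)
Lemma opposite_bracket i y : weight_vector (- l i) y -> exists2 z,
  vsval z = [< e`_i, y >] & forall b, b z = killing e`_i y * form b (l i).
Proof.
move=> ay; have zt : [< e`_i, y >] \in t.
  by apply: weight0_cartan; rewrite -(subrr (l i)); apply: weight_bracket.
exists (vsproj t [< e`_i, y >]) => [|b]; first by rewrite vsprojK.
rewrite dual_formE.
suff <- : sharp t (killing e`_i y *: l i) = vsproj t [< e`_i, y >].
  by rewrite linearZ /= linearZ.
rewrite -[RHS]flatK; congr (sharp t _); apply/lfunP => k.
rewrite flatE vsprojK // killing_invariant bracketC ay opp_lfunE scaleNr opprK.
by rewrite scale_lfunE linearZ /= [RHS]mulrC.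
Qed.

Lemma dual_string i b v : l i <> 0 -> weight_vector b v -> v <> 0 ->
  exists p m : nat,
    2%:R * (form b (l i) + p%:R * form (l i) (l i)) = m%:R * form (l i) (l i) /\
    forall k, (k <= m)%N ->
      exists2 u, u <> 0 & weight_vector (b + l i *+ p - l i *+ k) u.
Proof.
move=> li bv v0; have [y ay /eqP c0] := opposite_vector li.
have [z zE cE] := opposite_bracket ay.
have [p [m [E strm]]] := root_string li (eW i) ay zE bv v0.
exists p, m; split=> //; apply: (mulfI c0).
by move: E; rewrite !cE => E; rewrite -[RHS]mulrCA -E; ring.
Qed.

(** If [(a, a) = 0], the string relations make [a] orthogonal to all weights, so
    that the element of [t] representing it vanishes. *)
Lemma form_weight_neq0 i : l i <> 0 -> form (l i) (l i) != 0.
Proof.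
move=> li; apply/eqP => ii; apply: li; rewrite -[LHS]sharpK.
suff -> : sharp t (l i) = 0 by rewrite linear0.
apply: cartan_separated => j; rewrite -dual_formE.
have [li0|/eqP li] := eqVneq (l i) 0; first by rewrite li0 (form0r formP).
have [p [m [+ _]]] := dual_string li (eW j) (basis_neq0 (i := j)).
by rewrite ii !mulr0 addr0 => /eqP; rewrite mulf_eq0 pnatr_eq0 /= => /eqP.
Qed.

Lemma form_weight_ratio i j : l i <> 0 ->
  exists2 r : F, r \is Num.real & form (l j) (l i) = r * form (l i) (l i).
Proof.
move=> li; have [p [m [E _]]] := dual_string li (eW j) (basis_neq0 (i := j)).
exists (m%:R / 2%:R - p%:R); first by rewrite realB ?realM ?realV ?realn.
have n2 : (2%:R : F) != 0 by rewrite pnatr_eq0.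
apply: (mulfI n2); move: E; rewrite mulrDr => /(canRL (addrK _)) ->.
by field.
Qed.

(** [(a, a) = \sum_j (l j, a) ^+ 2 = (a, a) ^+ 2 * \sum_j r_j ^+ 2] with real
    ratios [r_j]. *)
Lemma form_weight_pos i : l i <> 0 -> 0 < form (l i) (l i).
Proof.
move=> li; have n0 := form_weight_neq0 li.
have /choice[r rP] : forall j, exists r : F, r \is Num.real /\
    form (l j) (l i) = r * form (l i) (l i).
  by move=> j; have [r] := form_weight_ratio j li; exists r.
have E : form (l i) (l i) = (\sum_j r j * r j) * form (l i) (l i) ^+ 2.
  rewrite {1}/dual_form killing_weights mulr_suml; apply: eq_bigr => j _.
  by rewrite -dual_formE; have [_ ->] := rP j; ring.
have s1 : (\sum_j r j * r j) * form (l i) (l i) = 1.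
  by apply: (mulIf n0); rewrite mul1r -mulrA -expr2 -E.
have s0 : 0 <= \sum_j r j * r j.
  by apply: sumr_ge0 => j _; rewrite -expr2 real_exprn_even_ge0 //; case: (rP j).
by rewrite lt0r n0 -(pmulr_rge0 _ (x := \sum_j r j * r j)) ?s1 ?ler01 //
  lt0r s0 andbT; apply/eqP => s00; move: s1; rewrite s00 mul0r => /eqP;
  rewrite eq_sym oner_eq0.
Qed.

Local Notation D := (lie_roots t).

Lemma root_index a : D a -> exists2 i, l i <> 0 & l i = a.
Proof. by rewrite lie_rootsE => -[a0 [i lE]]; exists i; rewrite ?lE. Qed.

Lemma weight_root b u : weight_vector b u -> u <> 0 -> b <> 0 -> D b.
Proof. by rewrite lie_rootsE => bu u0 b0; split=> //; apply: weight_index bu u0. Qed.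

Lemma root_opp a : D a -> D (- a).
Proof.
move=> /root_index[i li <-]; have [y ay xy] := opposite_vector li.
apply: weight_root ay _ _; first by move=> y0; apply: xy; rewrite y0 linear0.
by move=> /eqP; rewrite oppr_eq0 => /eqP.
Qed.

Lemma root_form_pos a : D a -> 0 < form a a.
Proof. by move=> /root_index[i li <-]; apply: form_weight_pos. Qed.

Lemma root_form_real a b : D a -> D b -> form a b \is Num.real.
Proof.
move=> /root_index[i li <-] /root_index[j lj <-].
have [r rr ->] := form_weight_ratio i lj.
by rewrite realM // ger0_real // ltW // form_weight_pos.
Qed.

(** Up to the condition that they be nonzero, the [b + a *+ p - a *+ k] form the
    string of [b] in the direction [a], [p] steps being above [b]. *)
Lemma root_strings a b : D a -> D b -> exists p m : nat,
  2%:R * form b a = (m%:R - 2%:R * p%:R) * form a a /\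
  forall k, (k <= m)%N -> b + a *+ p - a *+ k <> 0 -> D (b + a *+ p - a *+ k).
Proof.
move=> /root_index[i li <-] /root_index[j lj <-].
have [p [m [E strm]]] := dual_string li (eW j) (basis_neq0 (i := j)).
exists p, m; split; first by rewrite mulrBl -E; ring.
by move=> k /strm[u u0 bu] b0; apply: weight_root bu u0 b0.
Qed.

Lemma root_sub a b : D a -> D b -> 0 < form a b -> a <> b -> D (a - b).
Proof.
move=> Da Db ab neq; have [p [m [E strm]]] := root_strings Db Da.
have bb := root_form_pos Db.
have pm : (p.+1 <= m)%N.
  have : 0 < (m%:R - 2%:R * p%:R : F) by rewrite -(pmulr_lgt0 _ bb) -E mulr_gt0 ?ltr0n.
  by rewrite subr_gt0 -natrM ltr_nat; lia.
(* The string starts [p] steps above [a]; its [p.+1]-st element is [a - b]. *)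
have E' : a + b *+ p - b *+ p.+1 = a - b by rewrite mulrSr opprD addrA addrK.
by have := strm _ pm; rewrite E'; apply=> /eqP; rewrite subr_eq0 => /eqP.
Qed.

(** The string has length [m] and [b] is [p] steps below its top, with [2 * p <= m]:
    the reflected root is the one [p] steps above the bottom. *)
Let acute_reflection a b : D a -> D b -> 0 <= form b a ->
  D (b - form b (coroot form a) *: a).
Proof.
move=> Da Db ba; have [p [m [E strm]]] := root_strings Da Db.
have aa := root_form_pos Da; have aa0 : form a a != 0 by rewrite gt_eqF.
have cE : form b (coroot form a) = m%:R - 2%:R * p%:R.
  by rewrite (form_coroot formP) mulrAC E mulfK.
have pm : (2 * p <= m)%N.
  have : 0 <= (m%:R - 2%:R * p%:R : F) by rewrite -(pmulr_lge0 _ aa) -E mulr_ge0 ?ler0n.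
  by rewrite subr_ge0 -natrM ler_nat.
have rE : b - form b (coroot form a) *: a = b + a *+ p - a *+ (m - p).
  rewrite cE -addrA; congr (_ + _); rewrite -!scaler_nat -scalerBl -scaleNr.
  by congr (_ *: _); rewrite natrB ?[(p <= m)%N](leq_trans _ pm) ?leq_pmull //; ring.
rewrite rE; apply: strm; first exact: leq_subr.
rewrite -rE => r0; have bE : b = form b (coroot form a) *: a.
  by apply/eqP; rewrite -subr_eq0 r0.
have ba0 : form b a = 0.
  have := congr1 (form^~ a) r0; rewrite /= (form0l formP) (formBl formP).
  rewrite (form_scalel formP) (form_coroot formP) mulrAC divfK // => /eqP.
  by rewrite mulr_natl mulr2n opprD addrA subrr sub0r oppr_eq0 => /eqP.
have := root_form_pos Db.
by rewrite bE (form_coroot formP) ba0 mulr0 scale0r (form0l formP) ltxx.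
Qed.

Lemma root_reflection a b : D a -> D b -> D (b - form b (coroot form a) *: a).
Proof.
move=> Da Db; have /orP[ba|ba] : (0 <= form b a) || (form b a <= 0).
    exact: root_form_real.
  exact: acute_reflection.
have -> : form b (coroot form a) *: a = form b (coroot form (- a)) *: (- a).
  rewrite !(form_coroot formP) !(formNl formP) !(formNr formP) opprK.
  by rewrite mulrN scaleNr scalerN opprK.
apply: acute_reflection => //; first exact: root_opp.
by rewrite (formNr formP) oppr_ge0.
Qed.

Lemma lie_root_system : root_system form D.
Proof.
split; [exact: roots_are_finite | exact: root_opp | exact: root_form_real
  | exact: root_form_pos | exact: root_sub |].
move=> a b Da Db ab Dab; have bb := root_form_pos Db.
have := root_reflection Db Dab.
rewrite (form_coroot formP) (form_addl formP) ab add0r divfK ?gt_eqF //.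
by rewrite scaler_nat mulr2n opprD addrA addrK.
Qed.

(** The root vectors of one of two orthogonal parts of the roots, together with
    the brackets of the opposite ones, span an ideal. *)
Lemma lie_roots_irreducible : irreducible_system form D.
Proof.
split.
  have [i li] := weight_nonzero.
  by exists (l i); apply: weight_root (eW i) (basis_neq0 (i := i)) li.
move=> A B DE AB.
have DA a : A a -> D a by rewrite DE; left.
have DB a : B a -> D a by rewrite DE; right.
have selfA a : A a -> form a a <> 0 by move=> /DA/root_form_pos aa a0; rewrite a0 ltxx in aa.
have selfB a : B a -> form a a <> 0 by move=> /DB/root_form_pos aa a0; rewrite a0 ltxx in aa.
have linked a b : A a -> D b -> form a b <> 0 -> A b.
  by move=> Aa + ab; rewrite DE => -[//|/(AB _ _ Aa)].
have oppA a : A a -> A (- a).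
  move=> Aa; apply: (linked a) => //; first exact/root_opp/DA.
  by rewrite (formNr formP) => /eqP; rewrite oppr_eq0 => /eqP/selfA; apply.
have weight_neq0 i : A (l i) -> l i <> 0.
  by move=> /selfA ll li0; apply: ll; rewrite li0 (form0l formP).
pose n := \dim {:g}.
pose s1 := [seq e`_(val i) | i <- enum 'I_n & `[< A (l i) >]].
pose s2 := [seq [< e`_(val ij.1), e`_(val ij.2) >] | ij <- enum {: 'I_n * 'I_n} &
              `[< A (l ij.1) >] && (l ij.2 == - l ij.1)].
have mem1 i : A (l i) -> e`_i \in s1 ++ s2.
  move=> Ai; rewrite mem_cat; apply/orP; left; apply/mapP; exists i => //.
  by rewrite mem_filter mem_enum andbT; apply/asboolP.
have mem2 i j : A (l i) -> l j = - l i -> [< e`_i, e`_j >] \in s1 ++ s2.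
  move=> Ai lj; rewrite mem_cat; apply/orP; right; apply/mapP; exists (i, j) => //.
  by rewrite mem_filter mem_enum /= lj eqxx !andbT; apply/asboolP.
have inv_mem (u : g) : u \in s1 ++ s2 -> (exists2 i, A (l i) & u = e`_(val i)) \/
    (exists i j, [/\ A (l i), l j = - l i & u = [< e`_(val i), e`_(val j) >]]).
  rewrite mem_cat => /orP[]/mapP[].
    by move=> i; rewrite mem_filter => /andP[/asboolP Ai _] ->; left; exists i.
  move=> [i j]; rewrite mem_filter /= => /andP[/andP[/asboolP Ai /eqP lj] _] ->.
  by right; exists i, j.
have ideals : lie_ideal <<s1 ++ s2>>.
  apply: span_ideal => k u /inv_mem[[i Ai ->]|[i [j [Ai lj ->]]]].
    have [lki|/eqP lki] := eqVneq (l k + l i) 0.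
      have lk : l k = - l i by apply/eqP; rewrite -addr_eq0 lki.
      rewrite bracketC memvN; apply/memv_span/mem2 => //.
    apply: (weight_span (weight_bracket (eW k) (eW i))) => m lm; apply: mem1.
    have em : e`_m <> 0 := basis_neq0 (i := m).
    have Dm : D (l m) by apply: weight_root (eW m) em _; rewrite lm.
    have [Am|nAm] := pselect (A (l m)) => //.
    have Bm : B (l m) by move: Dm; rewrite DE => -[].
    have lk0 : l k <> 0 by move=> lk0; apply: nAm; rewrite lm lk0 add0r.
    have Dk : D (l k) := weight_root (eW k) (basis_neq0 (i := k)) lk0.
    have [Ak|nAk] := pselect (A (l k)).
      case: (selfB _ Bm); rewrite {1}lm (form_addl formP).
      by rewrite !(AB _ (l m)) ?addr0.
    have ki0 : form (l i) (l k) = 0 by apply: AB => //; move: Dk; rewrite DE => -[].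
    case: (selfA _ Ai); have := AB _ _ Ai Bm.
    by rewrite lm (formDr formP) ki0 add0r.
  have aj : weight_vector (- l i) e`_j by rewrite -lj.
  have [z zE cE] := opposite_bracket aj.
  rewrite -zE bracketC eW memvN.
  have [z0|/eqP z0] := eqVneq (l k z) 0; first by rewrite z0 scale0r mem0v.
  apply: memvZ; apply/memv_span/mem1; apply: (linked (l i)) => //.
    apply: weight_root (eW k) (basis_neq0 (i := k)) _ => lk0.
    by apply: z0; rewrite lk0 zero_lfunE.
  by rewrite (form_sym formP) => ki0; apply: z0; rewrite cE ki0 mulr0.
have [I0|If] := simpleG.2 _ ideals; [left | right]; apply/seteqP; split=> // a.
  move=> Aa; have [i li lE] := root_index (DA _ Aa).
  have : e`_i \in <<s1 ++ s2>>%VS by apply/memv_span/mem1; rewrite lE.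
  by rewrite I0 memv0 => /eqP; apply: basis_neq0.
move=> Ba; have [j lj lE] := root_index (DB _ Ba).
have : coord e j e`_j = 0.
  apply: (span_coord0 (s := s1 ++ s2)); last by rewrite If memvf.
  move=> u /inv_mem[[i Ai ->]|[i [k [Ai lk ->]]]].
    rewrite coord_e; have [ji|//] := eqVneq j i.
    by case: (selfA _ Ai); apply: AB => //; rewrite -ji lE.
  apply/eqP/negPn/negP => cu.
  have := coord_weight (weight_bracket (eW i) (eW k)) cu.
  by rewrite lk subrr.
by rewrite coord_e eqxx => /eqP; rewrite oner_eq0.
Qed.

End Weights.

(** * The maximal elements of the complement of the ideal *)

Lemma mem_opp_image (F : fieldType) (V : vectType F) (w : 'End(V)) (A : set V) c :
  lker w == 0%VS -> oppset (w @` A) c <-> A (- (w^-1)%VF c).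
Proof.
move=> kerw; split=> [[_ [a Aa <-] <-]|Ac].
  by rewrite linearN /= (lker0_lfunK kerw) opprK.
exists (w (- (w^-1)%VF c)); first by exists (- (w^-1)%VF c).
by rewrite linearN /= (lker0_lfunVK kerw) opprK.
Qed.

Section LieCascade.
Variables (F : numFieldType) (g : lieAlgType F) (t : {vspace g}).
Variable P : set (cartan_dual t).
Hypotheses (simpleG : simple_lie g) (cartanT : cartan_subalgebra t).
Hypothesis psP : positive_system (lie_roots t) P.

(** The choice of a weight basis is confined to this proof. *)
Lemma lie_cascade_data :
  [/\ symmetric_bilinear (dual_form t), root_system (dual_form t) (lie_roots t),
      irreducible_system (dual_form t) (lie_roots t),
      forall a b : cartan_dual t, lie_roots t a -> lie_roots t b ->
        lie_roots t (b - dual_form t b (coroot (dual_form t) a) *: a)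
    & forall a b : cartan_dual t, dual_form t a b = a (sharp t b)].
Proof.
have [e [l [eP eW]]] := weight_basis_exists cartanT; split.
- exact: (dual_form_bilinear eP eW).
- exact: (lie_root_system eP eW).
- exact: (lie_roots_irreducible eP eW).
- exact: (root_reflection eP eW).
- exact: (dual_formE eP eW).
Qed.

Lemma cascade_levelE i :
  cascade_level P i = [set a | P a /\ level (dual_form t) (lie_roots t) P a = i].
Proof.
have [formP rsD irrD _ formE] := lie_cascade_data.
suff levE (a : cartan_dual t) :
    a (cascade_element P) = level (dual_form t) (lie_roots t) P a.
  by apply/seteqP; split=> a [Pa la]; split=> //; rewrite -la levE.
have finK := cascade_finite rsD psP.
rewrite /cascade_element /level linearZ /= !fsbig_finite // linear_sum.
by congr (_ * _); apply: eq_bigr => b _; rewrite formE.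
Qed.

Theorem maximal_elements_cascade (w : 'End(cartan_dual t)) :
  cascade_weyl_element P w ->
  maximal_elements (simple_roots P) (P `\` cascade_ideal_roots P w) =
    oppset (w @` (simple_roots P `&` cascade_level P 1)).
Proof.
move=> [wW]; have [formP rsD irrD refl _] := lie_cascade_data.
have [wstab winj wonto] := weyl_bijective formP rsD refl wW.
rewrite /cascade_ideal_roots !cascade_levelE => inv_w.
exact: (maximal_complement formP rsD psP irrD wstab winj wonto inv_w).
Qed.

Theorem maximal_elements_cascadeP (w : 'End(cartan_dual t)) c :
  cascade_weyl_element P w ->
  maximal_elements (simple_roots P) (P `\` cascade_ideal_roots P w) c <->
    (simple_roots P `&` cascade_level P 1) (- (w^-1)%VF c).
Proof.
move=> wK; rewrite maximal_elements_cascade //; apply: mem_opp_image.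
have [formP rsD _ refl _] := lie_cascade_data.
by have [_ winj _] := weyl_bijective formP rsD refl wK.1; apply/lker0P.
Qed.

End LieCascade.

Theorem theorem6p7 (R : realType) (g : lieAlgType R[i]) (t : {vspace g})
    (P : set (cartan_dual t)) (w : 'End(cartan_dual t)) :
  simple_lie g ->
  cartan_subalgebra t ->
  positive_system (lie_roots t) P ->
  (forall p : nat, (1 <= p)%N ->
     ~ type_A (dual_form t) (simple_roots P) (2 * p)) ->
  cascade_weyl_element P w ->
  let Pi1 := simple_roots P `&` cascade_level P 1 in
  let M := maximal_elements (simple_roots P) (P `\` cascade_ideal_roots P w) in
  M = oppset (w @` Pi1) /\
  (forall c : cartan_dual t, P c -> (M c <-> Pi1 (- (w^-1)%VF c))).
Proof.
move=> simpleG cartanT psP _ wK Pi1 M; split=> [|c _].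
  exact: maximal_elements_cascade.
exact: maximal_elements_cascadeP.
Qed.
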